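(* Let $\mathcal S_1=\mathrm{span}\{1,z,\bar z\}\subseteq C(\mathbb T)$ and $\mathcal S_1^d=\mathrm{span}\{I,E_{12},E_{21}\}\subseteq M_2$. Then: (1) $\mathcal S_1\otimes_{\min}\mathcal S_1=\mathcal S_1\otimes_{\rm c}\mathcal S_1$; (2) $\mathcal S_1\otimes_{\rm c}\mathcal S_1\neq\mathcal S_1\otimes_{\max}\mathcal S_1$; (3) $\mathcal S_1\otimes_{\min}\mathcal S_1^d=\mathcal S_1\otimes_{\rm c}\mathcal S_1^d$; (4) $\mathcal S_1\otimes_{\rm c}\mathcal S_1^d\neq\mathcal S_1\otimes_{\max}\mathcal S_1^d$; (5) $\mathcal S_1^d\otimes_{\min}\mathcal S_1^d=\mathcal S_1^d\otimes_{\rm c}\mathcal S_1^d$; (6) $\mathcal S_1^d\otimes_{\rm c}\mathcal S_1^d\neq\mathcal S_1^d\otimes_{\max}\mathcal S_1^d$.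
   Context: $z$ denotes the identity function on the unit circle $\mathbb T$; $\mathcal S_1$ is the operator system of the generator of $\mathbb F_1$ in $C^*(\mathbb F_1)\cong C(\mathbb T)$, and $\mathrm{span}\{I,E_{12},E_{21}\}\subseteq M_2$ (matrix units $E_{ij}$) is completely order isomorphic to the matrix ordered dual of $\mathcal S_1$. Operator system tensor products: $\otimes_{\min}$ spatial; $\otimes_{\max}$ maximal (cones = Archimedeanization of $\{A^*(P\otimes Q)A\}$, $P,Q$ positive matrices over the factors, $A$ scalar); $\otimes_{\rm c}$ commuting (positivity tested by all $\phi\cdot\psi$, $\phi,\psi$ completely positive into a common $B(H)$ with commuting ranges, $(\phi\cdot\psi)(x\otimes y)=\phi(x)\psi(y)$). Equality means the identity map is a complete order isomorphism. *)

(* Defs.v *)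
From HB Require Import structures.
From mathcomp Require Import all_boot all_order all_algebra.
From mathcomp Require Import reals.
From mathcomp Require Import complex mxtens.
Set Implicit Arguments. Unset Strict Implicit. Unset Printing Implicit Defensive.
Import Order.TTheory GRing.Theory Num.Theory.
Local Open Scope ring_scope.

Section OpSys.
Variable R : realType.
Local Notation C := (R[i]).

Definition adjmx {m n} (A : 'M[C]_(m, n)) : 'M[C]_(n, m) := (map_mx (@conjc R) A)^T.

Definition psd {n} (A : 'M[C]_n) : Prop :=
  forall v : 'cV[C]_n, 0 <= (adjmx v *m A *m v) 0 0.

(* S_1 = span{1, z, zbar} in C(T).  An element of M_n(S_1) is written
   X 0 (x) 1 + X 1 (x) z + X 2 (x) zbar with X i : M_n(C).
   basis function values at a point w of the unit circle:               *)
Definition S1_basis (w : C) (i : 'I_3) : C :=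
  match val i with 0 => 1 | 1 => w | _ => conjc w end.

Definition on_circle (w : C) : Prop := `|w| = 1.

(* matrix cone of S_1, inherited from C(T): pointwise PSD on T *)
Definition S1_cone n (X : 'I_3 -> 'M[C]_n) : Prop :=
  forall w, on_circle w -> psd (\sum_(i < 3) S1_basis w i *: X i).

(* S_1^d = span{I, E12, E21} in M_2.  An element of M_n(S_1^d) is
   X 0 (x) I + X 1 (x) E12 + X 2 (x) E21, i.e. (after the canonical
   shuffle M_n(M_2) = M_2(M_n)) the block matrix [[X0, X1], [X2, X0]]. *)
Definition Sd_mx n (X : 'I_3 -> 'M[C]_n) : 'M[C]_(n + n) :=
  block_mx (X 0) (X 1) (X 2) (X 0).

Definition Sd_cone n (X : 'I_3 -> 'M[C]_n) : Prop := psd (Sd_mx X).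

(* A concrete finite-dimensional operator system: a basis of size k whose
   element of index 0 is the Archimedean order unit, and its matrix cones
   (elements of M_n(S) written in coordinates). *)
Record opsys := OpSys {
  os_dim : nat;
  os_unit : 'I_os_dim;
  os_cone : forall n, ('I_os_dim -> 'M[C]_n) -> Prop }.

Definition S1 : opsys := @OpSys 3 0 S1_cone.
Definition S1d : opsys := @OpSys 3 0 Sd_cone.

(* Elements of M_n(S (x) T) written in the basis e_i (x) f_j. *)
Definition tens_elt (S T : opsys) n := 'I_(os_dim S) -> 'I_(os_dim T) -> 'M[C]_n.

(* Maximal tensor product: D_n = { A^* (P (x) Q) A }, then Archimedeanize *)
Definition max_D (S T : opsys) n (X : tens_elt S T n) : Prop :=
  exists (p q : nat) (P : 'I_(os_dim S) -> 'M[C]_p) (Q : 'I_(os_dim T) -> 'M[C]_q)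
         (A : 'M[C]_(p * q, n)),
    os_cone P /\ os_cone Q /\
    forall i j, X i j = adjmx A *m (P i *t Q j) *m A.

Definition tens_unit (S T : opsys) n : tens_elt S T n :=
  fun i j => if (i == os_unit S) && (j == os_unit T) then 1%:M else 0.

Definition max_cone (S T : opsys) n (X : tens_elt S T n) : Prop :=
  forall e : R, 0 < e -> max_D (fun i j => X i j + (e%:C)%C *: @tens_unit S T n i j).

Definition inner_product (H : lmodType C) (ip : H -> H -> C) : Prop :=
  [/\ forall a x y z, ip (a *: x + y) z = a * ip x z + ip y z,
      forall x y, ip y x = conjc (ip x y),
      forall x, 0 <= ip x x &
      forall x, ip x x = 0 -> x = 0].

Definition complete_ip (H : lmodType C) (ip : H -> H -> C) : Prop :=
  forall u : nat -> H,
    (forall e : R, 0 < e -> exists N, forall m n, (N <= m)%N -> (N <= n)%N ->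
        ip (u m - u n) (u m - u n) < (e%:C)%C) ->
    exists x, forall e : R, 0 < e -> exists N, forall n, (N <= n)%N ->
        ip (u n - x) (u n - x) < (e%:C)%C.

Definition bounded_op (H : lmodType C) (ip : H -> H -> C) (T : H -> H) : Prop :=
  (forall a x y, T (a *: x + y) = a *: T x + T y) /\
  exists M : R, forall x, ip (T x) (T x) <= (M%:C)%C * ip x x.

(* the operator matrix (X entrywise applied by phi) in M_n(B(H)) = B(H^n)
   is positive: <T xi, xi> >= 0 for all xi in H^n *)
Definition op_mx_pos (H : lmodType C) (ip : H -> H -> C) k n
  (X : 'I_k -> 'M[C]_n) (phi : 'I_k -> H -> H) : Prop :=
  forall xi : 'I_n -> H,
    0 <= \sum_(a < n) \sum_(b < n) \sum_(i < k) X i a b * ip (phi i (xi b)) (xi a).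

(* a linear map S -> B(H), given by its values on the basis, is
   completely positive *)
Definition cp_map (S : opsys) (H : lmodType C) (ip : H -> H -> C)
  (phi : 'I_(os_dim S) -> H -> H) : Prop :=
  (forall i, bounded_op ip (phi i)) /\
  forall n (X : 'I_(os_dim S) -> 'M[C]_n), os_cone X -> op_mx_pos ip X phi.

Definition c_cone (S T : opsys) n (X : tens_elt S T n) : Prop :=
  forall (H : lmodType C) (ip : H -> H -> C),
    inner_product ip -> complete_ip ip ->
  forall (phi : 'I_(os_dim S) -> H -> H) (psi : 'I_(os_dim T) -> H -> H),
    cp_map ip phi -> cp_map ip psi ->
    (forall i j x, phi i (psi j x) = psi j (phi i x)) ->
    forall xi : 'I_n -> H,
      0 <= \sum_(a < n) \sum_(b < n) \sum_(i < os_dim S) \sum_(j < os_dim T)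
             X i j a b * ip (phi i (psi j (xi b))) (xi a).

(* Minimal (spatial) tensor products, via the concrete embeddings
   S_1 in C(T) and S_1^d in M_2:
   S_1 (x)min S_1 in C(T x T), S_1 (x)min S_1^d in C(T, M_2),
   S_1^d (x)min S_1^d in M_2 (x) M_2 = M_4; positivity is pointwise PSD. *)
Definition min_cone_S1S1 n (X : tens_elt S1 S1 n) : Prop :=
  forall w1 w2, on_circle w1 -> on_circle w2 ->
    psd (\sum_(i < 3) \sum_(j < 3) (S1_basis w1 i * S1_basis w2 j) *: X i j).

Definition min_cone_S1Sd n (X : tens_elt S1 S1d n) : Prop :=
  forall w, on_circle w ->
    psd (Sd_mx (fun j => \sum_(i < 3) S1_basis w i *: X i j)).

Definition min_cone_SdSd n (X : tens_elt S1d S1d n) : Prop :=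
  psd (Sd_mx (fun j => Sd_mx (fun i => X i j))).

(* equality of operator system structures: same cones at every level *)
Definition same_cones (S T : opsys) (P Q : forall n, tens_elt S T n -> Prop) : Prop :=
  forall n (X : tens_elt S T n), P n X <-> Q n X.

End OpSys.

(* Main.v *)
Require Import Defs.
From HB Require Import structures.
From mathcomp Require Import all_boot all_order all_algebra.
From mathcomp Require Import reals.
From mathcomp Require Import complex mxtens.
From mathcomp Require Import boolp classical_sets ring lra.

(* A completely positive map on S_1 is a positive 2 x 2 Toeplitz operator [[A, B], [B^*, A]];
   after replacing A by A + e it is approximated by averages, over roots of unity w, of
   positive operators F_w in the algebra it generates (a Fejer kernel for the contraction
   A^-1 B).  A completely positive map on S_1^d makes all tridiagonal Toeplitz operators
   with A on the diagonal and B, B^* beside it positive; the Schur complements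
   Z_(k+1) = A - B^* Z_k^-1 B give positive matrices [[Z_k, B], [B^*, A - Z_(k+1)]], so by
   telescoping the map is approximated by completely positive maps on M_2 with values in
   that algebra.  Both approximations commute with the second map, and a product of
   commuting positive operators is positive; this gives min = c.  The first approximation
   also shows that S_1 and S_1^d are in duality, so that positive elements of the minimal
   tensor product of the duals are positive functionals on the maximal tensor product.
   Explicit elements with negative pairing, built from two anticommuting Pauli matrices,
   separate c from max. *)

Set Implicit Arguments. Unset Strict Implicit. Unset Printing Implicit Defensive.
Import Order.TTheory GRing.Theory Num.Theory.
Local Notation Re := (@complex.Re _).
Local Notation Im := (@complex.Im _).
Local Open Scope complex_scope.
Local Open Scope ring_scope.

(** The obstacle to min = c is the second map. Dilating [phi] to a unitary (for S_1) or to a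
    representation of M_2 (for S_1^d) enlarges the space, and a commuting [psi] need not extend
    along the dilation. The approximants are therefore built on [H] itself, from [phi] by sums,
    products and inverses, so that whatever commutes with [phi] commutes with them. The shift by [e]
    makes the operators to be inverted coercive, and this is where completeness of [H] enters;
    letting [e] tend to 0 afterwards costs nothing because positivity is a closed condition.
    Operator square roots are avoided twice: a change of inner product replaces conjugation by
    [A^(-1/2)], and an iteration of F. Riesz replaces the square root in the proof that commuting
    positive operators have a positive product. For c against max, applying the duality twice makes
    matrices over the duals act as functionals on the generators [A^* (P (x) Q) A]. In the mixed
    case S_1, S_1^d the duality pairing itself separates, already at matrix level one. *)

Section ComplexNumbers.
Variable R : realType.
Local Notation C := (R[i]).
Implicit Types x y : C.

Lemma ReD x y : Re (x + y) = Re x + Re y. Proof. by case: x y => [a b] [c d]. Qed.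
Lemma ImD x y : Im (x + y) = Im x + Im y. Proof. by case: x y => [a b] [c d]. Qed.
Lemma ReN x : Re (- x) = - Re x. Proof. by case: x. Qed.
Lemma ImN x : Im (- x) = - Im x. Proof. by case: x. Qed.
Lemma ReM x y : Re (x * y) = Re x * Re y - Im x * Im y.
Proof. by case: x y => [a b] [c d]. Qed.
Lemma ImM x y : Im (x * y) = Re x * Im y + Im x * Re y.
Proof. by case: x y => [a b] [c d]. Qed.
Lemma Re_conjc x : Re (conjc x) = Re x. Proof. by case: x. Qed.
Lemma Im_conjc x : Im (conjc x) = - Im x. Proof. by case: x. Qed.

Lemma complex_ge0 x : 0 <= x <-> 0 <= Re x /\ Im x = 0.
Proof.
rewrite lecE /=; split => [/andP[/eqP -> ->]//|[-> ->]]; by rewrite eqxx.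
Qed.

Lemma complex_eq x y : Re x = Re y -> Im x = Im y -> x = y.
Proof. by case: x y => [a b] [c d] /= -> ->. Qed.

Lemma ex_natr_gt (a : R) : exists n : nat, a < n%:R.
Proof.
exists (Num.bound `|a|); apply: le_lt_trans (ler_norm _) _.
exact: archi_boundP.
Qed.

Lemma natr_real_complex (n : nat) : (n%:R : C) = (n%:R : R)%:C.
Proof. by rewrite rmorph_nat. Qed.

(** Stands in for dividing by [N] and passing to the limit; both the Fejer sums and the telescoping
    sums give bounds of this shape. [N = 0, 1] settle the imaginary part, the Archimedean property
    the real part. *)
Lemma ge0_of_affine x y : (forall N : nat, 0 <= N%:R * x + y) -> 0 <= x.
Proof.
move=> h; apply/complex_ge0; split; last first.
  have /complex_ge0[_] := h 0; have /complex_ge0[_] := h 1.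
  rewrite !mul0r mul1r add0r ImD => h1 h0; lra.
rewrite leNgt; apply/negP => xn.
have [n] : exists n : nat, Re y < n%:R * - Re x.
  have [n hn] := ex_natr_gt (Re y / - Re x).
  by exists n; rewrite -ltr_pdivrMr ?oppr_gt0.
have /complex_ge0[] := h n.
rewrite natr_real_complex ReD ReM /= mul0r subr0 => h1 _ h2; lra.
Qed.

Lemma ge0_of_eps x y : (forall e : R, 0 < e -> 0 <= x + e%:C * y) -> 0 <= x.
Proof.
move=> h; apply: (@ge0_of_affine _ (x + y)) => N.
have N0 : (0 : C) < N.+1%:R by rewrite ltr0Sn.
have := h (N.+1%:R^-1); rewrite invr_gt0 ltr0Sn => /(_ isT).
rewrite -(pmulr_rge0 _ N0) mulrDr mulrA fmorphV rmorph_nat divff ?gt_eqF //.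
by rewrite mul1r -addn1 natrD mulrDl mul1r -addrA.
Qed.

End ComplexNumbers.

(** * Positive operators *)

Section SemiInnerProduct.
Variables (R : realType) (H : lmodType R[i]) (ip : H -> H -> R[i]).
Local Notation C := (R[i]).

(** Without definiteness, so that positivity arguments carry over at once to derived forms such as
    [ffun_ip]. *)
Definition semi_ip : Prop :=
  [/\ forall a x y z, ip (a *: x + y) z = a * ip x z + ip y z,
      forall x y, ip y x = conjc (ip x y) &
      forall x, 0 <= ip x x].

Definition linop (T : H -> H) : Prop :=
  forall a x y, T (a *: x + y) = a *: T x + T y.

(** Real-valued, so that norm estimates become real arithmetic for [lra] and [nra]. *)
Definition re_ip (x y : H) : R := Re (ip x y).
Local Notation rp := re_ip.

Definition selfadj (T : H -> H) : Prop := forall x y, ip (T x) y = ip x (T y).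

Definition posop (T : H -> H) : Prop := forall x, 0 <= ip (T x) x.

Lemma inner_product_semi : inner_product ip -> semi_ip.
Proof. by case. Qed.

Hypothesis Hip : semi_ip.

Lemma ipC x y : ip y x = conjc (ip x y). Proof. by case: Hip. Qed.
Lemma ipDl x y z : ip (x + y) z = ip x z + ip y z.
Proof. by case: Hip => h _ _; have := h 1 x y z; rewrite scale1r mul1r. Qed.
Lemma ip0l z : ip 0 z = 0.
Proof. by have := ipDl 0 0 z; rewrite addr0 => /eqP; rewrite -subr_eq0 opprD addNKr oppr_eq0 => /eqP. Qed.
Lemma ipZl a x z : ip (a *: x) z = a * ip x z.
Proof. by case: Hip => h _ _; have := h a x 0 z; rewrite addr0 ip0l addr0. Qed.
Lemma ipNl x z : ip (- x) z = - ip x z.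
Proof. by rewrite -scaleN1r ipZl mulN1r. Qed.
Lemma ipBl x y z : ip (x - y) z = ip x z - ip y z.
Proof. by rewrite ipDl ipNl. Qed.
Lemma ip_suml (I : finType) (f : I -> H) z : ip (\sum_i f i) z = \sum_i ip (f i) z.
Proof. by apply: (big_morph (ip^~ z)) => [x y|]; rewrite ?ipDl ?ip0l. Qed.

Lemma ipDr x y z : ip x (y + z) = ip x y + ip x z.
Proof. by rewrite ipC ipDl rmorphD /= -!ipC. Qed.
Lemma ip0r x : ip x 0 = 0. Proof. by rewrite ipC ip0l rmorph0. Qed.
Lemma ipZr a x y : ip x (a *: y) = conjc a * ip x y.
Proof. by rewrite ipC ipZl rmorphM /= -ipC. Qed.
Lemma ipNr x y : ip x (- y) = - ip x y.
Proof. by rewrite ipC ipNl rmorphN /= -ipC. Qed.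
Lemma ipBr x y z : ip x (y - z) = ip x y - ip x z.
Proof. by rewrite ipDr ipNr. Qed.

Lemma rpC x y : rp y x = rp x y. Proof. by rewrite /re_ip ipC Re_conjc. Qed.
Lemma rpDl x y z : rp (x + y) z = rp x z + rp y z.
Proof. by rewrite /re_ip ipDl ReD. Qed.
Lemma rpDr x y z : rp x (y + z) = rp x y + rp x z.
Proof. by rewrite /re_ip ipDr ReD. Qed.
Lemma rpNl x z : rp (- x) z = - rp x z. Proof. by rewrite /re_ip ipNl ReN. Qed.
Lemma rpNr x z : rp x (- z) = - rp x z. Proof. by rewrite /re_ip ipNr ReN. Qed.
Lemma rpZl (a : R) x z : rp (a%:C *: x) z = a * rp x z.
Proof. by rewrite /re_ip ipZl ReM /= mul0r subr0. Qed.
Lemma rpZr (a : R) x z : rp x (a%:C *: z) = a * rp x z.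
Proof. by rewrite rpC rpZl rpC. Qed.
Definition rpE := (rpDl, rpDr, rpNl, rpNr, rpZl, rpZr).

Lemma rp_ge0 x : 0 <= rp x x.
Proof. by case: Hip => _ _ /(_ x) /complex_ge0[]. Qed.
Lemma ip_self x : ip x x = (rp x x)%:C.
Proof. by case: Hip => _ _ /(_ x) /complex_ge0[_ h]; exact: complex_eq. Qed.

Lemma linopD T x y : linop T -> T (x + y) = T x + T y.
Proof. by move=> h; have := h 1 x y; rewrite !scale1r. Qed.
Lemma linop0 T : linop T -> T 0 = 0.
Proof.
move=> h; have := linopD 0 0 h; rewrite addr0 => /eqP.
by rewrite -subr_eq0 opprD addNKr oppr_eq0 => /eqP.
Qed.
Lemma linopZ T a x : linop T -> T (a *: x) = a *: T x.
Proof. by move=> h; have := h a x 0; rewrite !addr0 (linop0 h) addr0. Qed.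
Lemma linopN T x : linop T -> T (- x) = - T x.
Proof. by move=> h; rewrite -scaleN1r (linopZ _ _ h) scaleN1r. Qed.
Lemma linopB T x y : linop T -> T (x - y) = T x - T y.
Proof. by move=> h; rewrite (linopD _ _ h) (linopN _ h). Qed.
Lemma linop_sum T (I : finType) (f : I -> H) : linop T ->
  T (\sum_i f i) = \sum_i T (f i).
Proof.
by move=> h; apply: (big_morph T) => [x y|]; rewrite ?(linopD _ _ h) ?(linop0 h).
Qed.

(* Polarization: the values at x + y and x + i y determine the sesquilinear form. *)
Lemma adjoint_of_real (S T : H -> H) : linop S -> linop T ->
  (forall x y, Im (ip (S x) y + ip (T y) x) = 0) ->
  forall x y, ip (S x) y = ip x (T y).
Proof.
move=> lS lT h x y; rewrite [RHS]ipC.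
have h1 := h x y; have := h x ('i *: y).
rewrite (linopZ _ _ lT) ipZl ipZr !(ImD, ImM, ReM, Re_conjc, Im_conjc) /= => h2.
rewrite ImD in h1.
apply: complex_eq; rewrite ?Re_conjc ?Im_conjc; lra.
Qed.

Lemma posop_selfadj T : linop T -> posop T -> selfadj T.
Proof.
move=> lT pT; apply: adjoint_of_real => // x y.
have /complex_ge0[_] := pT (x + y); have /complex_ge0[_] := pT x.
have /complex_ge0[_] := pT y.
rewrite (linopD _ _ lT) !ipDl !ipDr !ImD; lra.
Qed.

Lemma selfadj_posop T : selfadj T -> (forall x, 0 <= rp (T x) x) -> posop T.
Proof.
move=> sT h x; apply/complex_ge0; split; first exact: h.
have := sT x x; rewrite [RHS]ipC => e; have := congr1 (@complex.Im R) e.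
rewrite Im_conjc; lra.
Qed.

(** Expand [|t x - y|^2 >= 0]. The free weight [t] does the work of the Cauchy-Schwarz
    inequality. *)
Lemma rp_le_norms (t : R) x y : 0 < t -> 2 * rp x y <= t * rp x x + t^-1 * rp y y.
Proof.
move=> t0; have := rp_ge0 (t%:C *: x - y).
rewrite !rpE [rp y x]rpC => h.
rewrite -(ler_pM2l t0) mulrDr (mulrA t t^-1) divff ?gt_eqF // mul1r; nra.
Qed.

Lemma rpD_le x y : rp (x + y) (x + y) <= 2 * rp x x + 2 * rp y y.
Proof. have := rp_ge0 (x - y); rewrite !rpE [rp y x]rpC; lra. Qed.

Lemma small_of_norm_bound (x : H) (y : nat -> H) (c : R) :
  (forall n, n%:R * rp (y n) (y n) <= c) ->
  forall e : R, 0 < e -> exists n, `|rp x (y n)| < e.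
Proof.
move=> hy e e0.
have [n hn] : exists n : nat, (rp x x + 1) * (c + 1) < n%:R * (e * e).
  have [n hn] := ex_natr_gt ((rp x x + 1) * (c + 1) / (e * e)).
  by exists n; rewrite -ltr_pdivrMr ?mulr_gt0.
exists n; have := hy n; set b := rp (y n) (y n) => hb.
have x0 := rp_ge0 x; have b0 : 0 <= b by exact: rp_ge0.
have n0 : (0 : R) < n%:R.
  rewrite lt0r ler0n andbT; apply/negP => /eqP n0; move: hn hb.
  rewrite n0 !mul0r => hn hb; nra.
(* With this weight both terms of [rp_le_norms] are below [e]; the [+ 1] covers [x = 0]. *)
have t0 : 0 < e / (rp x x + 1) by rewrite divr_gt0 //; lra.
have p0 : 0 < rp x x + 1 by lra.
have ub : (e / (rp x x + 1))^-1 * b < e.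
  rewrite invf_div mulrAC ltr_pdivrMr // -(ltr_pM2l n0).
  have -> : n%:R * ((rp x x + 1) * b) = (rp x x + 1) * (n%:R * b) by ring.
  apply: le_lt_trans hn; rewrite ler_pM2l //; lra.
have lb : e / (rp x x + 1) * rp x x < e.
  rewrite mulrAC ltr_pdivrMr // ltr_pM2l //; lra.
rewrite ltr_norml; apply/andP; split.
  have := rp_le_norms x (- y n) t0; rewrite !rpE opprK -/b; lra.
have := rp_le_norms x (y n) t0; rewrite -/b; lra.
Qed.

End SemiInnerProduct.

Section CommutingPositive.
Variables (R : realType) (H : lmodType R[i]) (ip : H -> H -> R[i]).
Hypothesis Hip : semi_ip ip.
Local Notation rp := (re_ip ip).
Let rpE := (rpE Hip).

(* F. Riesz: with F_0 = F and F_(k+1) = F_k - F_k^2 one has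
   F = F_0^2 + ... + F_(n-1)^2 + F_n, so PF is, up to the vanishing term
   P F_n, a sum of the positive operators F_k P F_k. *)
Fixpoint riesz (F : H -> H) (k : nat) : H -> H :=
  if k is k'.+1 then fun x => riesz F k' x - riesz F k' (riesz F k' x) else F.

Definition unit_op (F : H -> H) : Prop :=
  [/\ linop F, selfadj ip F & forall x, 0 <= rp (F x) x <= rp x x].

(** [F - F^2 = F (1 - F) F + (1 - F) F (1 - F)] is a sum of positive operators, and
    [F - F^2 <= F <= 1]. *)
Lemma unit_op_step F : unit_op F -> unit_op (fun x => F x - F (F x)).
Proof.
move=> [lF sF hF]; have rs x y : rp (F x) y = rp x (F y) by rewrite /re_ip sF.
split.
- move=> a x y; rewrite (lF a) (lF a) opprD addrACA scalerBr //.
- by move=> x y; rewrite (ipBl Hip) (ipBr Hip) !sF.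
move=> x; have /andP[_ h1] := hF (F x); have /andP[h2 _] := hF (x - F x).
have /andP[_ h3] := hF x; have h4 := rp_ge0 Hip (F x).
have eB : F (x - F x) = F x - F (F x) by exact: linopB.
move: h1 h2; rewrite eB !rpE -!rs => h1 h2.
by rewrite -rs in h4; apply/andP; split; lra.
Qed.

Lemma riesz_unit F k : unit_op F -> unit_op (riesz F k).
Proof. by move=> h; elim: k => //= k; exact: unit_op_step. Qed.

(** The squares [|F_k x|^2] for [k < n] telescope to [<F x, x> - <F_n x, x>], and they decrease in
    [k], so each is at least [|F_n x|^2]. *)
Lemma riesz_norm_bound F x n : unit_op F ->
  n%:R * rp (riesz F n x) (riesz F n x) <= rp (F x) x.
Proof.
move=> hF.
suff : n%:R * rp (riesz F n x) (riesz F n x) <= rp (F x) x - rp (riesz F n x) x.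
  move/le_trans; apply; have [_ _ /(_ x) /andP[h _]] := riesz_unit n hF; lra.
elim: n => [|n IHn] /=; first by rewrite mul0r subrr.
have [lG sG hG] := riesz_unit n hF; set G := riesz F n in IHn lG sG hG *.
have rs u v : rp (G u) v = rp u (G v) by rewrite /re_ip sG.
have [y ey] : exists y, G x = y by exists (G x).
rewrite ey in IHn *.
have dec : rp (y - G y) (y - G y) <= rp y y.
  have /andP[h1 _] := hG y.
  have [_ _ /(_ y) /andP[h2 _]] := unit_op_step (riesz_unit n hF).
  by rewrite -/G in h2; move: h2 => /=; rewrite !rpE -!rs => h2; lra.
have e : rp (G y) x = rp y y by rewrite rs ey.
rewrite -natr1 mulrDl mul1r.
have : n%:R * rp (y - G y) (y - G y) <= n%:R * rp y y by rewrite ler_wpM2l.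
move: dec; rewrite [rp (y - G y) x]rpDl // [rp (- _) x]rpNl // e => *; lra.
Qed.

Lemma commuting_unit_pos F P : unit_op F -> linop P -> posop ip P ->
  (forall x, P (F x) = F (P x)) -> posop ip (fun x => P (F x)).
Proof.
move=> hF lP pP cPF.
have sP := posop_selfadj Hip lP pP; have [lF sF _] := hF.
have cG k x : P (riesz F k x) = riesz F k (P x).
  by elim: k x => //= k IH x; rewrite (linopB _ _ lP) !IH.
apply: (selfadj_posop Hip) => [x y|x]; first by rewrite sP sF cPF.
have key n : rp (P (riesz F n x)) x <= rp (P (F x)) x.
  elim: n => [|n IHn] //=; apply: le_trans IHn.
  have [_ sG _] := riesz_unit n hF.
  rewrite (linopB _ _ lP) !rpE (cG n (riesz F n x)).
  have : 0 <= rp (P (riesz F n x)) (riesz F n x) by have /complex_ge0[] := pP (riesz F n x).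
  rewrite /re_ip -sG; lra.
rewrite leNgt; apply/negP => neg.
have [n hn] := small_of_norm_bound Hip (P x)
  (fun n => riesz_norm_bound x n hF) (e := - rp (P (F x)) x) ltac:(by rewrite oppr_gt0).
have := key n; rewrite cG; have [_ sG _] := riesz_unit n hF.
rewrite /re_ip sG -/(rp (P x) (riesz F n x)).
have := ler_norm (- rp (P x) (riesz F n x)); rewrite normrN; lra.
Qed.

Lemma commuting_pos (F P : H -> H) (M : R) : linop F -> posop ip F ->
  (forall x, rp (F x) (F x) <= M * rp x x) -> linop P -> posop ip P ->
  (forall x, P (F x) = F (P x)) -> posop ip (fun x => P (F x)).
Proof.
move=> lF pF bF lP pP cPF x.
(* Since [2 <F u, u> <= |F u|^2 + |u|^2 <= (M + 1) |u|^2], this factor brings [F] below the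
   identity. *)
set c : R := (`|M| + 1)^-1.
have M0 : 0 < `|M| + 1 by have := normr_ge0 M; lra.
have c0 : 0 < c by rewrite invr_gt0.
have sF := posop_selfadj Hip lF pF.
have hU : unit_op (fun x => c%:C *: F x).
  split.
  - by move=> a u v; rewrite lF scalerDr !scalerA mulrC.
  - by move=> u v; rewrite (ipZl Hip) (ipZr Hip) sF conjc_real.
  move=> u; rewrite !rpE; have /complex_ge0[h _] := pF u.
  rewrite mulr_ge0 ?(ltW c0) //= mulrC ler_pdivrMr //.
  have := rp_le_norms Hip (F u) u (t := 1) ltr01; rewrite invr1 !mul1r.
  have := rp_ge0 Hip u; have := bF u; have := ler_norm M; rewrite -/(rp (F u) u) in h *.
  nra.
have := commuting_unit_pos hU lP pP _ x; rewrite (linopZ _ _ lP) (ipZl Hip).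
rewrite pmulr_rge0 ?ltcR //; apply=> y.
by rewrite (linopZ _ _ lP) cPF.
Qed.

End CommutingPositive.

(** * Bounded operators, finite direct sums, and products of positive operator matrices *)

Section BoundedOperators.
Variables (R : realType) (H : lmodType R[i]) (ip : H -> H -> R[i]).
Hypothesis Hip : semi_ip ip.
Local Notation rp := (re_ip ip).
Let rpE := (rpE Hip).

Lemma bounded_opP T : bounded_op ip T <->
  linop T /\ exists2 M : R, 0 <= M & forall x, rp (T x) (T x) <= M * rp x x.
Proof.
split=> -[lT [M]]; last first.
  move=> M0 hM; split=> //; exists M => x.
  by rewrite !(ip_self Hip) -rmorphM /= lecR.
move=> hM; split=> //; exists `|M| => // x; have := hM x.
rewrite !(ip_self Hip) -rmorphM /= lecR; move/le_trans; apply.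
by rewrite ler_wpM2r ?(rp_ge0 Hip) // ler_norm.
Qed.

Lemma bounded_linop T : bounded_op ip T -> linop T. Proof. by case. Qed.

Lemma bounded_id : bounded_op ip (fun x => x).
Proof. by apply/bounded_opP; split=> //; exists 1 => // x; rewrite mul1r. Qed.

Lemma bounded_0 : bounded_op ip (fun=> 0).
Proof.
apply/bounded_opP; split; first by move=> a x y; rewrite scaler0 addr0.
by exists 0 => // x; rewrite mul0r /re_ip (ip0l Hip).
Qed.

Lemma bounded_add S T : bounded_op ip S -> bounded_op ip T ->
  bounded_op ip (fun x => S x + T x).
Proof.
move=> /bounded_opP[lS [M M0 hM]] /bounded_opP[lT [N N0 hN]]; apply/bounded_opP.
split; first by move=> a x y; rewrite lS lT scalerDr addrACA.
exists (2 * M + 2 * N) => [|x]; first by lra.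
by apply: le_trans (rpD_le Hip _ _) _; have := hM x; have := hN x; lra.
Qed.

Lemma bounded_comp S T : bounded_op ip S -> bounded_op ip T ->
  bounded_op ip (fun x => S (T x)).
Proof.
move=> /bounded_opP[lS [M M0 hM]] /bounded_opP[lT [N N0 hN]]; apply/bounded_opP.
split; first by move=> a x y; rewrite lT lS.
exists (M * N) => [|x]; first by rewrite mulr_ge0.
by apply: le_trans (hM _) _; rewrite -mulrA ler_wpM2l.
Qed.

Lemma bounded_scale (c : R[i]) : bounded_op ip (fun x => c *: x).
Proof.
apply/bounded_opP; split; first by move=> a x y; rewrite scalerDr !scalerA mulrC.
exists (Re (c * conjc c)) => [|x].
  by have /complex_ge0[] := mulcJ_ge0 c.
rewrite {1}/re_ip (ipZl Hip) (ipZr Hip) mulrA (ip_self Hip).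
by move: (c * conjc c) => d; rewrite ReM /= mulr0 subr0.
Qed.

Lemma bounded_opp T : bounded_op ip T -> bounded_op ip (fun x => - T x).
Proof.
move=> bT; have := bounded_comp (bounded_scale (-1)) bT.
by congr bounded_op; apply: functional_extensionality_dep => x; rewrite scaleN1r.
Qed.

Lemma bounded_sum (I : finType) (T : I -> H -> H) :
  (forall i, bounded_op ip (T i)) -> bounded_op ip (fun x => \sum_i T i x).
Proof.
move=> bT; elim: (index_enum I) => [|i r IH].
  have := bounded_0; congr bounded_op; apply: functional_extensionality_dep => x.
  by rewrite big_nil.
have := bounded_add (bT i) IH; congr bounded_op.
by apply: functional_extensionality_dep => x; rewrite big_cons.
Qed.

Lemma bounded_iter T n : bounded_op ip T -> bounded_op ip (iter n T).
Proof.
move=> bT; elim: n => [|n IH]; first exact: bounded_id.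
exact: (bounded_comp bT IH).
Qed.

Lemma row_bound (I : finType) (T : I -> H -> H) : (forall i, bounded_op ip (T i)) ->
  exists2 M : R, 0 <= M & forall y : I -> H,
    rp (\sum_i T i (y i)) (\sum_i T i (y i)) <= M * \sum_i rp (y i) (y i).
Proof.
move=> bT; elim: (index_enum I) => [|i r [M M0 IH]].
  by exists 0 => // y; rewrite !big_nil mul0r /re_ip (ip0l Hip).
have /bounded_opP[_ [N N0 hN]] := bT i.
exists (2 * N + 2 * M) => [|y]; first by lra.
rewrite !big_cons; apply: le_trans (rpD_le Hip _ _) _.
have := hN (y i); have := IH y; have := rp_ge0 Hip (y i).
have : 0 <= \sum_(j <- r) rp (y j) (y j) by apply: sumr_ge0 => j _; exact: rp_ge0.
by nra.
Qed.

End BoundedOperators.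

Section FiniteSums.
Variable (R : realType) (I : finType).

Lemma Re_sum (f : I -> R[i]) : Re (\sum_i f i) = \sum_i Re (f i).
Proof. by apply: (big_morph (fun z : R[i] => Re z)) => // x y; rewrite ReD. Qed.

Variables (H : lmodType R[i]) (ip : H -> H -> R[i]).

Definition ffun_ip (f g : {ffun I -> H}) : R[i] := \sum_i ip (f i) (g i).

Lemma ffun_semi_ip : semi_ip ip -> semi_ip ffun_ip.
Proof.
move=> Hip; split.
- move=> a x y z; rewrite /ffun_ip mulr_sumr -big_split /=; apply: eq_bigr => i _.
  by rewrite !ffunE (ipDl Hip) (ipZl Hip).
- by move=> x y; rewrite /ffun_ip rmorph_sum /=; apply: eq_bigr => i _; exact: ipC.
- by move=> x; apply: sumr_ge0 => i _; case: Hip.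
Qed.

Lemma ffun_rp f g : re_ip ffun_ip f g = \sum_i re_ip ip (f i) (g i).
Proof. by rewrite /re_ip /ffun_ip Re_sum. Qed.

End FiniteSums.

Section ProductOfPositives.
Variables (R : realType) (H : lmodType R[i]) (ip : H -> H -> R[i]).
Hypothesis Hip : semi_ip ip.
Variables (S I : finType) (k : nat) (Y : S -> S -> 'I_k -> I -> I -> R[i]).
Variables (Cp : S -> S -> H -> H) (psi : 'I_k -> H -> H).
Hypothesis bCp : forall p q, bounded_op ip (Cp p q).
Hypothesis lpsi : forall j, linop (psi j).
Hypothesis comm : forall p q j x, Cp p q (psi j x) = psi j (Cp p q x).
Hypothesis posCp : forall eta : S -> H, 0 <= \sum_p \sum_q ip (Cp p q (eta q)) (eta p).
Hypothesis posY : forall xi : S -> I -> H,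
  0 <= \sum_p \sum_q \sum_a \sum_b \sum_j Y p q j a b * ip (psi j (xi q b)) (xi p a).

(** Two separate legs indexed by [S]: [opY] acts on the first leg (with [I] and [H]), [opC] on the
    second (with [H]), so they commute as soon as [Cp] and [psi] do. *)
Let K := {ffun S -> {ffun S -> {ffun I -> H}}}.
Let ipK : K -> K -> R[i] := ffun_ip (ffun_ip (ffun_ip ip)).
Let opY (f : K) : K := [ffun p => [ffun s => [ffun a =>
  \sum_q \sum_b \sum_j Y p q j a b *: psi j (f q s b)]]].
Let opC (f : K) : K := [ffun p => [ffun s => [ffun a => \sum_t Cp s t (f p t a)]]].

Let ipK_semi : semi_ip ipK.
Proof. by do 3!apply: ffun_semi_ip. Qed.

Let lCp p q : linop (Cp p q) := bounded_linop (bCp p q).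

(* The product of the commuting positive operators opY and opC, evaluated at
   sum_p e_p (x) e_p (x) xi. *)
Lemma product_pos (xi : I -> H) :
  0 <= \sum_p \sum_q \sum_a \sum_b \sum_j Y p q j a b * ip (Cp p q (psi j (xi b))) (xi a).
Proof.
have lY : linop opY.
  move=> c x y; apply/ffunP => p; rewrite !ffunE; apply/ffunP => s; rewrite !ffunE.
  apply/ffunP => a; rewrite !ffunE scaler_sumr -big_split /=; apply: eq_bigr => q _.
  rewrite scaler_sumr -big_split /=; apply: eq_bigr => b _.
  rewrite scaler_sumr -big_split /=; apply: eq_bigr => j _.
  by rewrite !ffunE (lpsi j c) scalerDr !scalerA mulrC.
have lC : linop opC.
  move=> c x y; apply/ffunP => p; rewrite !ffunE; apply/ffunP => s; rewrite !ffunE.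
  apply/ffunP => a; rewrite !ffunE scaler_sumr -big_split /=; apply: eq_bigr => q _.
  by rewrite !ffunE lCp.
have pY : posop ipK opY.
  move=> f; rewrite /ipK /ffun_ip exchange_big /=; apply: sumr_ge0 => s _.
  have := posY (fun p a => f p s a); congr (0 <= _).
  apply: eq_bigr => p _; rewrite exchange_big /=; apply: eq_bigr => a _.
  rewrite !ffunE (ip_suml Hip); apply: eq_bigr => q _.
  rewrite (ip_suml Hip); apply: eq_bigr => b _.
  rewrite (ip_suml Hip); apply: eq_bigr => j _; by rewrite (ipZl Hip).
have pC : posop ipK opC.
  move=> f; rewrite /ipK /ffun_ip; apply: sumr_ge0 => p _.
  rewrite exchange_big /=; apply: sumr_ge0 => a _.
  have := posCp (fun s => f p s a); congr (0 <= _); apply: eq_bigr => s _.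
  by rewrite !ffunE (ip_suml Hip).
have [M hM] : exists M : R, forall f, re_ip ipK (opC f) (opC f) <= M * re_ip ipK f f.
  have /choice[M hM] : forall s : S, exists M : R, 0 <= M /\ forall y : S -> H,
      re_ip ip (\sum_i Cp s i (y i)) (\sum_i Cp s i (y i)) <= M * \sum_i re_ip ip (y i) (y i).
    by move=> s; have [M M0 h] := row_bound Hip (bCp s); exists M.
  exists (\sum_s M s) => f; rewrite !ffun_rp mulr_sumr; apply: ler_sum => p _.
  rewrite !ffun_rp mulr_suml; apply: ler_sum => s _.
  rewrite !ffun_rp (eq_bigr (fun t => \sum_a re_ip ip (f p t a) (f p t a))); last first.
    by move=> t _; rewrite ffun_rp.
  rewrite exchange_big mulr_sumr /=; apply: ler_sum => a _.
  by rewrite !ffunE; have [_] := hM s; exact.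
have cYC f : opY (opC f) = opC (opY f).
  apply/ffunP => p; rewrite !ffunE; apply/ffunP => s; rewrite !ffunE.
  apply/ffunP => a; rewrite !ffunE.
  under [RHS]eq_bigr => t _.
    rewrite !ffunE (linop_sum _ (lCp _ _)).
    under eq_bigr => q _.
      rewrite (linop_sum _ (lCp _ _)).
      under eq_bigr => b _.
        rewrite (linop_sum _ (lCp _ _)).
        under eq_bigr => j _ do rewrite (linopZ _ _ (lCp _ _)) comm.
        over.
      over.
    over.
  rewrite [RHS]exchange_big /=; apply: eq_bigr => q _.
  rewrite [RHS]exchange_big /=; apply: eq_bigr => b _.
  rewrite [RHS]exchange_big /=; apply: eq_bigr => j _.
  by rewrite !ffunE (linop_sum _ (lpsi j)) scaler_sumr.
pose zeta : K := [ffun p => [ffun s => [ffun a => if p == s then xi a else 0]]].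
have := commuting_pos ipK_semi lC pC hM lY pY cYC zeta.
congr (0 <= _); rewrite {1}/ipK /ffun_ip; apply: eq_bigr => p _.
rewrite (bigD1 p) //= [X in _ + X]big1 ?addr0; last first.
  move=> s sp; rewrite big1 // => a _; rewrite [zeta]lock !ffunE -lock !ffunE.
  by rewrite eq_sym (negbTE sp) (ip0r Hip).
rewrite [RHS]exchange_big /=; apply: eq_bigr => a _.
have -> : zeta p p a = xi a by rewrite !ffunE eqxx.
rewrite [zeta]lock !ffunE -lock (ip_suml Hip); apply: eq_bigr => q _.
rewrite (ip_suml Hip); apply: eq_bigr => b _.
rewrite (ip_suml Hip); apply: eq_bigr => j _; rewrite (ipZl Hip); congr (_ * _).
rewrite [zeta]lock !ffunE -lock (bigD1 q) //= big1 ?addr0.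
  by rewrite !ffunE eqxx comm.
by move=> t tq; rewrite !ffunE eq_sym (negbTE tq) (linop0 (lCp _ _)).
Qed.

End ProductOfPositives.

(** * Inverses of coercive operators *)

Section CoerciveInverse.
Variables (R : realType) (H : lmodType R[i]) (ip : H -> H -> R[i]).
Hypothesis ipP : inner_product ip.
Hypothesis ip_complete : complete_ip ip.
Let Hip : semi_ip ip := inner_product_semi ipP.
Local Notation rp := (re_ip ip).
Let rpE := (rpE Hip).

Definition coercive (e : R) (T : H -> H) : Prop :=
  0 < e /\ forall x, e * rp x x <= rp (T x) x.

(** [rp_le_norms] with weight [e], the term [e |x|^2] being absorbed by coercivity. *)
Lemma coercive_norm e T x : coercive e T ->
  e ^+ 2 * rp x x <= rp (T x) (T x).
Proof.
move=> [e0 h]; have := h x; have := rp_le_norms Hip x (T x) e0.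
rewrite [rp x (T x)](rpC Hip) => h1 h2.
have h3 : e * rp x x <= e^-1 * rp (T x) (T x) by lra.
by rewrite expr2 -mulrA -ler_pdivlMl.
Qed.

Lemma rp_eq0 x : rp x x = 0 -> x = 0.
Proof.
by move=> h; case: ipP => _ _ _; apply; rewrite (ip_self Hip) h.
Qed.

Lemma rp_small0 x : (forall d : R, 0 < d -> rp x x < d) -> x = 0.
Proof.
move=> h; apply: rp_eq0; apply/eqP; rewrite eq_le (rp_ge0 Hip) andbT leNgt.
by apply/negP => /h; rewrite ltxx.
Qed.

Lemma coercive_inj e T x y : linop T -> coercive e T -> T x = T y -> x = y.
Proof.
move=> lT cT exy; apply/eqP; rewrite -subr_eq0; apply/eqP/rp_eq0.
have := coercive_norm (x - y) cT; rewrite (linopB _ _ lT) exy subrr.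
rewrite [X in _ <= X]/re_ip (ip0l Hip) /= => h; have [e0 _] := cT.
have := rp_ge0 Hip (x - y).
have e2 : 0 < e ^+ 2 by rewrite exprn_gt0.
move: h; rewrite pmulr_rle0 // => h1 h2; apply/eqP; rewrite eq_le h1; exact: h2.
Qed.

(* Richardson iteration: the residuals y - T u_n decay geometrically. *)
Lemma coercive_surj e T y : bounded_op ip T -> coercive e T -> exists x, T x = y.
Proof.
move=> /(bounded_opP Hip)[lT [M M0 hM]] cT; have [e0 he] := cT.
(* One step multiplies [|r|^2] by at most [1 - 2 c e + c^2 M'], which is minimal, with value
   [1 - h], at [c = e / M']. Enlarging [M] to [M'] ensures [M' > 0] and [h < 1]. *)
pose M' := M + e ^+ 2 + 1; have e2 : 0 < e ^+ 2 by rewrite exprn_gt0.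
have M'0 : 0 < M' by rewrite /M'; lra.
pose c := e / M'; pose h := e ^+ 2 / M'.
have h0 : 0 < h by rewrite divr_gt0.
have h1 : h < 1 by rewrite ltr_pdivrMr // mul1r /M'; lra.
pose u := fix u n := if n is n'.+1 then u n' + c%:C *: (y - T (u n')) else 0.
have [r rE] : exists r : nat -> H, forall n, r n = y - T (u n) by eexists.
have rS n : r n.+1 = r n - c%:C *: T (r n).
  by rewrite [LHS]rE /= -rE (linopD _ _ lT) (linopZ _ _ lT) opprD addrA -rE.
(* Decay of order [1/n] is enough, and [(1 + (n+1) h) (1 - h) <= 1 + n h] carries the induction
   without powers of [1 - h]. *)
have rbound n : (1 + n%:R * h) * rp (r n) (r n) <= rp y y.
  elim: n => [|n IH]; first by rewrite rE /= (linop0 lT) subr0 mul0r addr0 mul1r.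
  have step : rp (r n.+1) (r n.+1) <= (1 - h) * rp (r n) (r n).
    rewrite rS !rpE [rp (r n) (T (r n))](rpC Hip).
    set a := rp (r n) (r n); set b := rp (T (r n)) (r n); set d := rp (T (r n)) (T (r n)).
    have c0 : 0 < c by rewrite divr_gt0.
    have hb : c * (e * a) <= c * b by rewrite ler_pM2l //; exact: he.
    have hd : c * (c * d) <= c * (c * (M' * a)).
      rewrite !ler_pM2l //; apply: le_trans (hM _) _; rewrite ler_wpM2r ?(rp_ge0 Hip) //.
      by rewrite /M'; lra.
    have e1 : c * (c * (M' * a)) = h * a by rewrite /c /h; field; rewrite gt_eqF.
    have e3 : c * (e * a) = h * a by rewrite /c /h; field; rewrite gt_eqF.
    lra.
  apply: le_trans IH; have a0 := rp_ge0 Hip (r n).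
  have n0 : (0 : R) <= n%:R by [].
  have nh : 0 <= n%:R * h by rewrite mulr_ge0 // ltW.
  apply: le_trans (_ : _ <= (1 + n.+1%:R * h) * ((1 - h) * rp (r n) (r n))) _.
    rewrite ler_wpM2l // addr_ge0 // mulr_ge0 //; exact: ltW.
  rewrite mulrA ler_wpM2r // -natr1; nra.
have rsmall (d : R) : 0 < d -> exists N, forall n, (N <= n)%N -> rp (r n) (r n) < d.
  move=> d0; have [N hN] := ex_natr_gt (rp y y / (d * h)).
  exists N => n Nn; have := rbound n.
  have dh : 0 < d * h by exact: mulr_gt0.
  rewrite ltr_pdivrMr // in hN.
  have Nn' : (N%:R : R) <= n%:R by rewrite ler_nat.
  have p0 : 0 < 1 + n%:R * h by rewrite ltr_pwDl // mulr_ge0 // ltW.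
  move=> hb; rewrite -(ltr_pM2l p0); apply: le_lt_trans hb _.
  have : N%:R * (d * h) <= n%:R * (d * h) by rewrite ler_wpM2r // ltW.
  lra.
have [x hx] : exists x, forall e : R, 0 < e -> exists N, forall n, (N <= n)%N ->
    ip (u n - x) (u n - x) < e%:C.
  apply: ip_complete => d d0.
  have [N hN] := rsmall (e ^+ 2 * d / 4) ltac:(by rewrite divr_gt0 ?mulr_gt0).
  exists N => m n Nm Nn; rewrite (ip_self Hip) ltcR -(ltr_pM2l e2).
  apply: le_lt_trans (coercive_norm _ cT) _.
  have -> : T (u m - u n) = r n - r m.
    by rewrite (linopB _ _ lT) !rE opprB [RHS]addrC addrA addrNK.
  apply: le_lt_trans (rpD_le Hip _ _) _; rewrite !rpE opprK.
  have := hN m Nm; have := hN n Nn; lra.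
exists x; apply/eqP; rewrite -subr_eq0; apply/eqP/rp_small0 => d d0.
have [N1 hN1] := rsmall (d / 4) ltac:(lra).
have K0 : 0 < M * 4 + 1 by lra.
have [N2 hN2] := hx (d / (M * 4 + 1)) ltac:(by rewrite divr_gt0).
pose n := maxn N1 N2.
have -> : T x - y = - T (u n - x) - r n.
  by rewrite (linopB _ _ lT) !rE !opprB addrA addrNK.
apply: le_lt_trans (rpD_le Hip _ _) _; rewrite !rpE !opprK.
have := hN1 n (leq_maxl _ _); have := hN2 n (leq_maxr _ _).
rewrite (ip_self Hip) ltcR ltr_pdivlMr // => a1 a2; have := hM (u n - x).
have := rp_ge0 Hip (u n - x); lra.
Qed.

(** Total by choice, with default 0 off the range; for bounded coercive [T] it is the inverse. *)
Definition opinv (T : H -> H) (y : H) : H := xget 0 (fun x => T x = y).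

Lemma opinvK e T y : bounded_op ip T -> coercive e T -> T (opinv T y) = y.
Proof.
move=> bT cT; have ex := coercive_surj y bT cT.
exact: (xgetPex 0 (P := fun x => T x = y) ex).
Qed.

Lemma opinv_unique e T x y : bounded_op ip T -> coercive e T -> T x = y ->
  opinv T y = x.
Proof.
move=> bT cT exy; apply: (coercive_inj (bounded_linop bT) cT).
by rewrite (opinvK _ bT cT).
Qed.

Lemma opinv_bounded e T : bounded_op ip T -> coercive e T ->
  bounded_op ip (opinv T).
Proof.
move=> bT cT; apply/(bounded_opP Hip); split.
  move=> a x y; apply: (opinv_unique bT cT).
  by rewrite (bounded_linop bT) !(opinvK _ bT cT).
have [e0 _] := cT; have e2 : 0 < e ^+ 2 by rewrite exprn_gt0.
exists (e ^+ 2)^-1 => [|x]; first by rewrite invr_ge0 ltW.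
rewrite mulrC ler_pdivlMr // mulrC.
by apply: le_trans (coercive_norm _ cT) _; rewrite (opinvK _ bT cT).
Qed.

Lemma opinv_comm e T S x : bounded_op ip T -> coercive e T ->
  (forall x, T (S x) = S (T x)) -> opinv T (S x) = S (opinv T x).
Proof.
move=> bT cT h; apply: (opinv_unique bT cT).
by rewrite h (opinvK _ bT cT).
Qed.

Lemma opinv_selfadj e T : bounded_op ip T -> coercive e T -> selfadj ip T ->
  selfadj ip (opinv T).
Proof.
by move=> bT cT sT x y; rewrite -{2}(opinvK x bT cT) sT (opinvK _ bT cT).
Qed.

End CoerciveInverse.

(** * Positive Toeplitz operators and S_1 *)

Section RootsOfUnity.
Variable R : realType.
Local Notation C := (R[i]).

(** A [2^k]-th root of -1 has order dividing [2^(k+1)] but not [2^k]. Arbitrarily large orders are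
    all that the averages over the circle require. *)
Lemma ex_prim_root2 k : exists z : C, (2 ^ k.+1).-primitive_root z.
Proof.
pose z : C := (2 ^ k).-root (-1).
have z1 : z ^+ (2 ^ k) = -1 by rewrite rootCK // expn_gt0.
have z2 : z ^+ (2 ^ k.+1) = 1 by rewrite expnS mulnC exprM z1 sqrrN expr1n.
have [m pm] := prim_order_exists (expn_gt0 2 k.+1 : 0 < 2 ^ k.+1)%N z2.
move=> /(dvdn_pfactor _ _ (isT : prime 2))[j jk mE].
exists z; suff -> : k.+1 = j by rewrite -mE.
apply/eqP; rewrite eqn_leq jk andbT ltnNge; apply/negP => jk'.
have : z ^+ (2 ^ k) == 1 by rewrite -(prim_order_dvd pm) mE dvdn_exp2l.
by rewrite z1 -subr_eq0 -opprD oppr_eq0 -(natrD _ 1 1) pnatr_eq0.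
Qed.

Lemma prim_root_circle M (z : C) t : M.-primitive_root z -> on_circle (z ^+ t).
Proof.
move=> pz; rewrite /on_circle normrX.
suff -> : `|z| = 1 by rewrite expr1n.
apply/eqP; rewrite -(@pexpr_eq1 _ _ M) ?(prim_order_gt0 pz) //.
by rewrite -normrX (prim_expr_order pz) normr1.
Qed.

Lemma sum_prim_root M (z : C) m : M.-primitive_root z -> (m < M)%N ->
  \sum_(t < M) (z ^+ t) ^+ m = if m == 0 then M%:R else 0.
Proof.
move=> pz mM; case: eqP => [->|/eqP m0].
  by under eq_bigr do rewrite expr0; rewrite sumr_const card_ord.
have zm : z ^+ m != 1.
  by rewrite -(prim_order_dvd pz) gtnNdvd // lt0n.
under eq_bigr do rewrite exprAC.
have := subrXX (z ^+ m) 1 M; rewrite expr1n -exprM mulnC exprM (prim_expr_order pz).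
rewrite expr1n subrr => /esym /eqP; rewrite mulf_eq0 subr_eq0 (negbTE zm) /=.
under eq_bigr do rewrite expr1n mulr1.
rewrite (reindex_inj rev_ord_inj) /= => /eqP h; rewrite -[RHS]h.
apply: eq_bigr => t _; congr (_ ^+ _); case: M t {pz mM h} => [[]//|M] t.
by rewrite subSS /= subKn // -ltnS.
Qed.

Lemma circle_conj (w : C) : on_circle w -> w * conjc w = 1.
Proof. by move=> h; rewrite -sqr_normc h expr1n. Qed.

End RootsOfUnity.

(** * Fejer kernels of contractions and their averages over roots of unity *)

Section FejerKernel.
Variables (R : realType) (H : lmodType R[i]) (ip : H -> H -> R[i]).
Hypothesis Hip : semi_ip ip.
Local Notation rp := (re_ip ip).
Let rpE := (rpE Hip).

Lemma iter_scale (c : R[i]) (T : H -> H) m x : linop T ->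
  iter m (fun y => c *: T y) x = c ^+ m *: iter m T x.
Proof.
move=> lT; elim: m => [|m IH]; first by rewrite scale1r.
by rewrite !iterS IH (linopZ _ _ lT) scalerA exprS.
Qed.

(* With s_n = x + U x + ... + U^n x the n-th summand is
   |s_n|^2 - |U s_(n-1)|^2 >= |s_n|^2 - |s_(n-1)|^2. *)
Lemma fejer_pos U N x : linop U -> (forall y, rp (U y) (U y) <= rp y y) ->
  0 <= \sum_(j < N) (rp x x + \sum_(m < j) 2 * rp (iter m.+1 U x) x).
Proof.
move=> lU cU; case: N => [|N]; first by rewrite big_ord0.
pose s n := \sum_(m < n.+1) iter m U x.
have sS n : s n.+1 = x + U (s n) by rewrite /s big_ord_recl (linop_sum _ lU).
suff h : rp (s N) (s N) <= \sum_(j < N.+1) (rp x x + \sum_(m < j) 2 * rp (iter m.+1 U x) x).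
  by apply: le_trans h; exact: rp_ge0.
elim: N => [|N IH].
  by rewrite big_ord_recr !big_ord0 /s big_ord_recl big_ord0 /= addr0 add0r addr0.
rewrite big_ord_recr /=.
have -> : \sum_(m < N.+1) 2 * rp (iter m.+1 U x) x = 2 * rp (U (s N)) x.
  rewrite -mulr_sumr; congr (_ * _).
  by rewrite /s (linop_sum _ lU) /re_ip (ip_suml Hip) Re_sum.
rewrite sS (rpDl Hip) !(rpDr Hip) [rp x (U _)](rpC Hip).
have := cU (s N); lra.
Qed.

End FejerKernel.

Section OperatorForm.
Variables (R : realType) (H : lmodType R[i]) (ip : H -> H -> R[i]).
Hypothesis Hip : semi_ip ip.
Variables (I : finType) (k : nat) (X : 'I_3 -> 'I_k -> I -> I -> R[i]).
Variables (psi : 'I_k -> H -> H) (xi : I -> H).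

(** The [i]-th part of the form to be shown positive, with [phi i] replaced by a variable operator:
    linear in [T], so approximants can be substituted. *)
Definition opform (i : 'I_3) (T : H -> H) : R[i] :=
  \sum_a \sum_b \sum_j X i j a b * ip (T (psi j (xi b))) (xi a).

Lemma eq_opform i S T : S =1 T -> opform i S = opform i T.
Proof. by move=> h; do 3!(apply: eq_bigr => ? _); rewrite h. Qed.

Lemma opform_sum i (J : finType) (c : J -> R[i]) (T : J -> H -> H) :
  opform i (fun x => \sum_t c t *: T t x) = \sum_t c t * opform i (T t).
Proof.
rewrite /opform; under [RHS]eq_bigr do rewrite mulr_sumr.
rewrite [RHS]exchange_big; apply: eq_bigr => a _ /=.
under [RHS]eq_bigr do rewrite mulr_sumr.
rewrite [RHS]exchange_big; apply: eq_bigr => b _ /=.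
under [RHS]eq_bigr do rewrite mulr_sumr.
rewrite [RHS]exchange_big; apply: eq_bigr => j _ /=.
rewrite (ip_suml Hip) mulr_sumr; apply: eq_bigr => t _.
by rewrite (ipZl Hip) mulrCA.
Qed.

Lemma opformZ i (c : R[i]) T : opform i (fun x => c *: T x) = c * opform i T.
Proof.
have := @opform_sum i 'I_1 (fun=> c) (fun=> T); rewrite big_ord1 => <-.
by apply: eq_opform => x; rewrite big_ord1.
Qed.

Lemma opformD i S T : opform i (fun x => S x + T x) = opform i S + opform i T.
Proof.
have := @opform_sum i bool (fun=> 1) (fun b => if b then S else T).
rewrite big_bool !mul1r => <-.
by apply: eq_opform => x; rewrite big_bool !scale1r.
Qed.

Lemma opform_mix (c : 'I_3 -> R[i]) T :
  \sum_a \sum_b \sum_j (\sum_i c i * X i j a b) * ip (T (psi j (xi b))) (xi a) =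
  \sum_i c i * opform i T.
Proof.
rewrite /opform; under [RHS]eq_bigr do rewrite mulr_sumr.
rewrite [RHS]exchange_big; apply: eq_bigr => a _ /=.
under [RHS]eq_bigr do rewrite mulr_sumr.
rewrite [RHS]exchange_big; apply: eq_bigr => b _ /=.
under [RHS]eq_bigr do rewrite mulr_sumr.
rewrite [RHS]exchange_big; apply: eq_bigr => j _ /=.
by rewrite mulr_suml; apply: eq_bigr => i _; rewrite mulrA.
Qed.

Lemma big_ord3 (F : 'I_3 -> R[i]) : \sum_i F i = F 0 + F 1 + F 2.
Proof.
rewrite !big_ord_recl big_ord0 addr0 addrA.
by congr (_ + F _ + F _); apply/val_inj.
Qed.

Lemma opformE (phi : 'I_3 -> H -> H) :
  \sum_a \sum_b \sum_i \sum_j X i j a b * ip (phi i (psi j (xi b))) (xi a) =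
  opform 0 (phi 0) + opform 1 (phi 1) + opform 2 (phi 2).
Proof.
rewrite -(big_ord3 (fun i => opform i (phi i))).
rewrite /opform [RHS]exchange_big; apply: eq_bigr => a _ /=.
by rewrite [RHS]exchange_big.
Qed.

End OperatorForm.

Section ToeplitzPositive.
Variables (R : realType) (H : lmodType R[i]) (ip : H -> H -> R[i]).
Hypothesis ipP : inner_product ip.
Hypothesis ip_complete : complete_ip ip.
Let Hip : semi_ip ip := inner_product_semi ipP.
Local Notation rp := (re_ip ip).
Let rpE := (rpE Hip).

Variable phi : 'I_3 -> H -> H.
Hypothesis bphi : forall i, bounded_op ip (phi i).
Hypothesis toeplitz_pos : forall x y,
  0 <= ip (phi 0 x) x + ip (phi 1 y) x + ip (phi 2 x) y + ip (phi 0 y) y.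

Let lphi i : linop (phi i) := bounded_linop (bphi i).

Lemma toeplitz_pos0 : posop ip (phi 0).
Proof.
move=> x; have := toeplitz_pos x 0.
by rewrite !(linop0 (lphi _)) !(ip0l Hip) (ip0r Hip) !addr0.
Qed.

Lemma toeplitz_adjoint x y : ip (phi 1 x) y = ip x (phi 2 y).
Proof.
apply: (adjoint_of_real Hip (lphi _) (lphi _)) => {}x {}y.
have /complex_ge0[_] := toeplitz_pos y x; have /complex_ge0[_] := toeplitz_pos0 x.
have /complex_ge0[_] := toeplitz_pos0 y; rewrite !ImD; lra.
Qed.

Variable e : R.
Hypothesis e0 : 0 < e.
Let A x := phi 0 x + e%:C *: x.

Let bA : bounded_op ip A.
Proof. exact: (bounded_add Hip (bphi 0) (bounded_scale Hip _)). Qed.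
Let lA : linop A := bounded_linop bA.
Let sA : selfadj ip A.
Proof.
have s0 := posop_selfadj Hip (lphi 0) toeplitz_pos0.
move=> x y; rewrite /A (ipDl Hip) (ipDr Hip) s0 (ipZl Hip) (ipZr Hip).
by rewrite conjc_real.
Qed.
Let cA : coercive ip e A.
Proof.
split=> // x; rewrite /A !rpE; have /complex_ge0[h _] := toeplitz_pos0 x.
by rewrite lerDr.
Qed.
Let D := opinv A.
Let AD x : A (D x) = x. Proof. exact: (opinvK ipP ip_complete _ bA cA). Qed.
Let bD : bounded_op ip D. Proof. exact: (opinv_bounded ipP ip_complete bA cA). Qed.
Let B x := D (phi 1 x).
Let B' x := D (phi 2 x).
Let bB : bounded_op ip B. Proof. exact: bounded_comp. Qed.
Let bB' : bounded_op ip B'. Proof. exact: bounded_comp. Qed.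
(** In this form [B = A^-1 phi_1] is a contraction with adjoint [B'], as [A^(-1/2) phi_1 A^(-1/2)]
    would be for [ip]. *)
Let ipA x y := ip (A x) y.

Let ipA_semi : semi_ip ipA.
Proof.
split.
- by move=> a x y z; rewrite /ipA lA (ipDl Hip) (ipZl Hip).
- by move=> x y; rewrite /ipA sA; exact: ipC.
- move=> x; apply: (selfadj_posop Hip) => // y.
  have [_ h] := cA; apply: le_trans (h y).
  by rewrite mulr_ge0 ?(rp_ge0 Hip) // ltW.
Qed.

Let B_contr y : re_ip ipA (B y) (B y) <= re_ip ipA y y.
Proof.
(* With [A] in both corners, [- B y] is the first entry minimizing the form for given [y]; the
   identity [phi_1 y = A (B y)] then leaves [<A y, y> - <A (B y), B y>]. *)
have /complex_ge0[] := toeplitz_pos (- B y) y.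
have e1 : rp (phi 2 (B y)) y = rp (phi 1 y) (B y).
  by rewrite (rpC Hip) [RHS]/re_ip toeplitz_adjoint.
rewrite !(linopN _ (lphi _)) !ReD -!/(rp _ _) !rpE opprK e1.
have -> : rp (phi 1 y) (B y) = rp (A (B y)) (B y) by rewrite AD.
rewrite /re_ip /ipA -!/(rp _ _) /A !rpE.
have := mulr_ge0 (ltW e0) (rp_ge0 Hip y); have := mulr_ge0 (ltW e0) (rp_ge0 Hip (B y)).
lra.
Qed.

Let B_adj m x : ipA (iter m B' x) x = conjc (ipA (iter m B x) x).
Proof.
have adj u v : ipA (B' u) v = ipA u (B v).
  rewrite /ipA AD [RHS]sA AD (ipC Hip) -toeplitz_adjoint.
  by rewrite -(ipC Hip).
suff h u v : ipA (iter m B' u) v = ipA u (iter m B v) by rewrite h; exact: ipC.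
by elim: m u v => // m IH u v; rewrite iterS adj IH -iterSr.
Qed.

(** The Fejer kernel without the factor [1/N]: terms of degree [m] and [-m] occur [N - m] times. The
    factor [A] turns [B] and [B'] back into [phi_1] and [phi_2]. *)
Let fejer (N : nat) (w : R[i]) (x : H) : H :=
  \sum_(j < N) (A x + \sum_(m < j) (conjc w ^+ m.+1 *: A (iter m.+1 B x)
                                   + w ^+ m.+1 *: A (iter m.+1 B' x))).

Let fejer_bounded N w : bounded_op ip (fejer N w).
Proof.
apply: bounded_sum => // j; apply: bounded_add => //; apply: bounded_sum => // m.
have bs c T : bounded_op ip T -> bounded_op ip (fun x => c *: T x).
  by move=> bT; apply: (bounded_comp Hip (bounded_scale Hip c) bT).
apply: bounded_add => //; apply: bs.
  exact: (bounded_comp Hip bA (bounded_iter Hip m.+1 bB)).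
exact: (bounded_comp Hip bA (bounded_iter Hip m.+1 bB')).
Qed.

Let fejer_ge0 N w : on_circle w -> posop ip (fejer N w).
Proof.
move=> hw x; pose U y := conjc w *: B y.
have lU : linop U.
  by move=> a u v; rewrite /U (bounded_linop bB) scalerDr !scalerA mulrC.
have cU y : re_ip ipA (U y) (U y) <= re_ip ipA y y.
  apply: le_trans (B_contr y); rewrite /U /re_ip (ipZl ipA_semi) (ipZr ipA_semi).
  by rewrite mulrA conjcK mulrC (mulrC (conjc w)) circle_conj // mulr1.
have := fejer_pos ipA_semi N x lU cU; rewrite -ler0c; congr (0 <= _).
rewrite /fejer (ip_suml Hip) rmorph_sum /=; apply: eq_bigr => j _.
rewrite (ipDl Hip) -/(ipA x x) (ip_self ipA_semi) rmorphD /=; congr (_ + _).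
rewrite (ip_suml Hip) rmorph_sum /=; apply: eq_bigr => m _.
rewrite (ipDl Hip) !(ipZl Hip) -!/(ipA _ _).
have -> : U (iter m U x) = conjc w ^+ m.+1 *: B (iter m B x).
  exact: (iter_scale _ m.+1 x (bounded_linop bB)).
rewrite /re_ip (ipZl ipA_semi).
have := B_adj m.+1 x; rewrite !iterS => ->.
set z := ipA (B _) x.
have -> : w ^+ m.+1 * conjc z = conjc (conjc w ^+ m.+1 * z).
  by rewrite rmorphM /= rmorphXn /= conjcK.
by rewrite addcJ rmorphM /= rmorph_nat.
Qed.

Variables (I : finType) (k : nat) (X : 'I_3 -> 'I_k -> I -> I -> R[i]).
Variables (psi : 'I_k -> H -> H).
Hypothesis lpsi : forall j, linop (psi j).
Hypothesis comm : forall i j x, phi i (psi j x) = psi j (phi i x).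
Hypothesis circle_pos : forall w, on_circle w -> forall xi : I -> H,
  0 <= \sum_a \sum_b \sum_j (\sum_i S1_basis w i * X i j a b)
                             * ip (psi j (xi b)) (xi a).
Variable xi : I -> H.
Let g := opform ip X psi xi.

Let fejer_comm N w j x : fejer N w (psi j x) = psi j (fejer N w x).
Proof.
have Ac y : A (psi j y) = psi j (A y).
  by rewrite /A comm (linopD _ _ (lpsi j)) (linopZ _ _ (lpsi j)).
have Dc y : D (psi j y) = psi j (D y) by exact: (opinv_comm ipP ip_complete _ bA cA).
have Bc m y : iter m B (psi j y) = psi j (iter m B y).
  by elim: m => // m IH; rewrite !iterS IH /B comm Dc.
have B'c m y : iter m B' (psi j y) = psi j (iter m B' y).
  by elim: m => // m IH; rewrite !iterS IH /B' comm Dc.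
rewrite /fejer (linop_sum _ (lpsi j)); apply: eq_bigr => i _.
rewrite Ac [RHS](linopD _ _ (lpsi j)); congr (_ + _).
rewrite (linop_sum _ (lpsi j)); apply: eq_bigr => m _.
by rewrite Bc B'c !Ac [RHS](linopD _ _ (lpsi j)) !(linopZ _ _ (lpsi j)).
Qed.

Let fejer_form N w : on_circle w ->
  0 <= \sum_i S1_basis w i * g i (fejer N w).
Proof.
move=> hw.
have := @product_pos _ _ _ Hip 'I_1 I k
   (fun _ _ j a b => \sum_i S1_basis w i * X i j a b)
   (fun _ _ => fejer N w) psi (fun _ _ => fejer_bounded N w) lpsi
   (fun _ _ => @fejer_comm N w) _ _ xi.
have h1 (eta : 'I_1 -> H) : 0 <= \sum_(p < 1) \sum_(q < 1) ip (fejer N w (eta q)) (eta p).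
  by rewrite !big_ord1; exact: fejer_ge0.
have h2 (zeta : 'I_1 -> I -> H) : 0 <= \sum_(p < 1) \sum_(q < 1)
    \sum_a \sum_b \sum_j (\sum_i S1_basis w i * X i j a b) * ip (psi j (zeta q b)) (zeta p a).
  by rewrite !big_ord1; exact: circle_pos.
by move=> /(_ h1 h2); rewrite !big_ord1 (opform_mix ip X psi xi).
Qed.

Let sum_first n (v : H) : \sum_(j < n.+1) \sum_(m < j) (if m == 0 :> nat then v else 0) = v *+ n.
Proof.
rewrite big_ord_recl big_ord0 add0r -[n in RHS]card_ord -sumr_const.
apply: eq_bigr => j _; rewrite lift0 big_ord_recl /= big1 ?addr0 // => m _.
Qed.

(** Extracts a Fourier coefficient of the kernel of length [n + 1]: degree 0 occurs in all [n + 1]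
    inner sums, degree 1 or -1 only in the [n] with [j > 0]. *)
Let fejer_avg n s z (c : 'I_(2 ^ s.+1) -> R[i]) (c0 : R[i]) (v : H) x :
  (2 ^ s.+1).-primitive_root z ->
  \sum_t c t = c0 ->
  (forall m, (m < n)%N ->
    (\sum_t c t * conjc (z ^+ t) ^+ m.+1) *: A (iter m.+1 B x)
     + (\sum_t c t * (z ^+ t) ^+ m.+1) *: A (iter m.+1 B' x) = if m == 0 :> nat then v else 0) ->
  \sum_t c t *: fejer n.+1 (z ^+ t) x = (c0 * n.+1%:R) *: A x + v *+ n.
Proof.
move=> pz hc hm.
rewrite /fejer; under eq_bigr => t _ do rewrite scaler_sumr.
rewrite exchange_big /=.
have -> : (c0 * n.+1%:R) *: A x = \sum_(j < n.+1) c0 *: A x.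
  by rewrite sumr_const card_ord scalerMnl mulr_natr.
rewrite -sum_first -big_split /=; apply: eq_bigr => j _.
under eq_bigr => t _ do rewrite scalerDr scaler_sumr.
rewrite big_split /= -scaler_suml hc; congr (_ + _).
rewrite exchange_big /=; apply: eq_bigr => m _.
rewrite -hm; last by apply: (leq_trans (ltn_ord m)); rewrite -ltnS.
by rewrite !scaler_suml -big_split /=; apply: eq_bigr => t _; rewrite scalerDr !scalerA.
Qed.

Lemma fejer_limit_step n :
  0 <= n%:R * (g 0 A + g 1 (phi 1) + g 2 (phi 2)) + g 0 A.
Proof.
(* Degrees reach [n], and one more after multiplication by [w] or its conjugate; the order must
   exceed them all so that no unwanted power averages to 1. *)
have [s ns] : exists s, (n.+2 < 2 ^ s.+1)%N.
  by exists n.+1; apply: leq_trans (ltn_expl n.+2 (isT : 1 < 2)%N) _.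
have [z pz] := ex_prim_root2 R s.
set M := (2 ^ s.+1)%N in ns pz.
have S m : (m < M)%N -> \sum_(t < M) (z ^+ t) ^+ m = if m == 0 then M%:R else 0.
  exact: sum_prim_root.
have S' m : (m < M)%N -> \sum_(t < M) conjc (z ^+ t) ^+ m = if m == 0 then M%:R else 0.
  move=> mM; have := congr1 (@conjc R) (S m mM).
  rewrite rmorph_sum /=; under eq_bigr do rewrite rmorphXn /=.
  by move=> ->; case: ifP => _; rewrite ?conjc_nat ?conjc0.
have circ t : z ^+ t * conjc (z ^+ t) = 1 by apply/circle_conj/(prim_root_circle t pz).
have lt1 m : (m < n)%N -> (m.+1 < M)%N.
  by move=> mn; apply: leq_trans ns; rewrite !ltnS ltnW // ltnW.
have lt2 m : (m < n)%N -> (m.+2 < M)%N.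
  by move=> mn; apply: leq_trans ns; rewrite !ltnS ltnW.
have lt0 m : (m < n)%N -> (m < M)%N by move=> /lt1/ltnW.
have M0 : (0 : R[i]) < M%:R by rewrite ltr0n expn_gt0.
have : 0 <= \sum_(t < M) \sum_i S1_basis (z ^+ t) i * g i (fejer n.+1 (z ^+ t)).
  by apply: sumr_ge0 => t _; apply: fejer_form; exact: prim_root_circle pz.
have avg i : \sum_(t < M) S1_basis (z ^+ t) i * g i (fejer n.+1 (z ^+ t)) =
    g i (fun x => \sum_(t < M) S1_basis (z ^+ t) i *: fejer n.+1 (z ^+ t) x).
  by rewrite /g (opform_sum Hip).
rewrite exchange_big /= 3!big_ord_recl big_ord0 addr0 !avg.
have -> : g ord0 (fun x => \sum_(t < M) S1_basis (z ^+ t) ord0 *: fejer n.+1 (z ^+ t) x) =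
   M%:R * (n.+1%:R * g 0 A).
  rewrite mulrA -(opformZ Hip); apply: eq_opform => x.
  rewrite (@fejer_avg n s z _ M%:R 0 x pz) ?mul0rn ?addr0 //.
    by rewrite sumr_const card_ord.
  move=> m mn; under eq_bigr do rewrite mul1r.
  under [X in _ + X *: _]eq_bigr do rewrite mul1r.
  by rewrite S ?S' ?lt1 //= !scale0r addr0 if_same.
have -> : g (lift ord0 ord0) (fun x => \sum_(t < M) S1_basis (z ^+ t) (lift ord0 ord0) *: fejer n.+1 (z ^+ t) x) =
   M%:R * (n%:R * g 1 (phi 1)).
  have -> : lift ord0 ord0 = 1 :> 'I_3 by apply/val_inj.
  rewrite mulrA -(opformZ Hip); apply: eq_opform => x.
  rewrite (@fejer_avg n s z _ 0 (M%:R *: phi 1 x) x pz) ?mul0r ?scale0r ?add0r //.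
  - by rewrite -scaler_nat scalerA mulrC.
  - rewrite /S1_basis /= -[RHS](S 1%N); last by apply: leq_trans ns.
    by apply: eq_bigr => t _; rewrite expr1.
  move=> m mn; rewrite /S1_basis /=.
  under eq_bigr do rewrite exprS mulrA circ mul1r.
  under [X in _ + X *: _]eq_bigr do rewrite -exprS.
  rewrite (S _ (lt2 _ mn)) (S' _ (lt0 _ mn)) /= scale0r addr0.
  by case: eqP => [->|_]; rewrite ?scale0r //= AD.
have -> : g (lift ord0 (lift ord0 ord0))
    (fun x => \sum_(t < M) S1_basis (z ^+ t) (lift ord0 (lift ord0 ord0)) *: fejer n.+1 (z ^+ t) x) =
   M%:R * (n%:R * g 2 (phi 2)).
  have -> : lift ord0 (lift ord0 ord0) = 2 :> 'I_3 by apply/val_inj.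
  rewrite mulrA -(opformZ Hip); apply: eq_opform => x.
  rewrite (@fejer_avg n s z _ 0 (M%:R *: phi 2 x) x pz) ?mul0r ?scale0r ?add0r //.
  - by rewrite -scaler_nat scalerA mulrC.
  - rewrite /S1_basis /= -[RHS](S' 1%N); last by apply: leq_trans ns.
    by apply: eq_bigr => t _; rewrite expr1.
  move=> m mn; rewrite /S1_basis /=.
  under eq_bigr do rewrite -exprS.
  under [X in _ + X *: _]eq_bigr do rewrite exprS mulrA [conjc _ * _]mulrC circ mul1r.
  rewrite (S' _ (lt2 _ mn)) (S _ (lt0 _ mn)) /= scale0r add0r.
  by case: eqP => [->|_]; rewrite ?scale0r //= AD.
rewrite -!mulrDr pmulr_rge0 // -natr1; congr (0 <= _); ring.
Qed.

Lemma fejer_limit : 0 <= g 0 (phi 0) + g 1 (phi 1) + g 2 (phi 2) + e%:C * g 0 id.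
Proof.
have := ge0_of_affine fejer_limit_step.
have -> : g 0 A = g 0 (phi 0) + e%:C * g 0 id.
  by rewrite -(opformZ Hip) -(opformD Hip).
by congr (0 <= _); ring.
Qed.

End ToeplitzPositive.

(** Positivity of [psi] is asked only through the fibres over the circle. This covers both choices
    of second factor and, with [psi] the identity, the duality of S_1 and S_1^d. *)
Lemma toeplitz_commuting_pos (R : realType) (H : lmodType R[i]) (ip : H -> H -> R[i])
  (phi : 'I_3 -> H -> H) (I : finType) (k : nat) (X : 'I_3 -> 'I_k -> I -> I -> R[i])
  (psi : 'I_k -> H -> H) :
  inner_product ip -> complete_ip ip -> (forall i, bounded_op ip (phi i)) ->
  (forall x y, 0 <= ip (phi 0 x) x + ip (phi 1 y) x + ip (phi 2 x) y + ip (phi 0 y) y) ->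
  (forall j, linop (psi j)) ->
  (forall i j x, phi i (psi j x) = psi j (phi i x)) ->
  (forall w, on_circle w -> forall xi : I -> H,
    0 <= \sum_a \sum_b \sum_j (\sum_i S1_basis w i * X i j a b)
                               * ip (psi j (xi b)) (xi a)) ->
  forall xi : I -> H,
  0 <= \sum_a \sum_b \sum_i \sum_j X i j a b * ip (phi i (psi j (xi b))) (xi a).
Proof.
move=> ipP ipc bphi tp lpsi comm cp xi; rewrite (opformE ip X psi xi phi).
apply: ge0_of_eps => e e0.
exact: (fejer_limit ipP ipc bphi tp e0 lpsi comm cp xi).
Qed.

(** * Tridiagonal Toeplitz operators and S_1^d *)

Section TridiagonalPositive.
Variables (R : realType) (H : lmodType R[i]) (ip : H -> H -> R[i]).
Hypothesis ipP : inner_product ip.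
Hypothesis ip_complete : complete_ip ip.
Let Hip : semi_ip ip := inner_product_semi ipP.
Local Notation rp := (re_ip ip).
Let rpE := (rpE Hip).

(** The entries of [I], [E_12], [E_21], with [false] as the first index. *)
Definition Sd_basis (i : 'I_3) (p q : bool) : R[i] :=
  match val i with 0 => (p == q)%:R | 1 => (~~ p && q)%:R | _ => (p && ~~ q)%:R end.

Variable phi : 'I_3 -> H -> H.
Hypothesis bphi : forall i, bounded_op ip (phi i).
Hypothesis tridiag_pos : forall n (x : nat -> H),
  0 <= \sum_(a < n.+1) ip (phi 0 (x a)) (x a)
     + \sum_(a < n) (ip (phi 1 (x a)) (x a.+1) + ip (phi 2 (x a.+1)) (x a)).

Let lphi i : linop (phi i) := bounded_linop (bphi i).

Lemma tridiag_pos0 : posop ip (phi 0).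
Proof. by move=> x; have := tridiag_pos 0 (fun=> x); rewrite big_ord1 big_ord0 addr0. Qed.

Lemma tridiag_adjoint x y : ip (phi 1 x) y = ip x (phi 2 y).
Proof.
apply: (adjoint_of_real Hip (lphi _) (lphi _)) => {}x {}y.
have /complex_ge0[_] := tridiag_pos 1 (fun n => if n is 0 then x else y).
have /complex_ge0[_] := tridiag_pos0 x; have /complex_ge0[_] := tridiag_pos0 y.
by rewrite !big_ord_recl !big_ord0 /= !addr0 !ImD; lra.
Qed.

Let tridiag_adjoint' x y : ip (phi 2 x) y = ip x (phi 1 y).
Proof. by rewrite (ipC Hip) -tridiag_adjoint -(ipC Hip). Qed.

Variable e : R.
Hypothesis e0 : 0 < e.
Let A x := phi 0 x + e%:C *: x.

Let bA : bounded_op ip A.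
Proof. exact: (bounded_add Hip (bphi 0) (bounded_scale Hip _)). Qed.
Let sA : selfadj ip A.
Proof.
have s0 := posop_selfadj Hip (lphi 0) tridiag_pos0.
move=> x y; rewrite /A (ipDl Hip) (ipDr Hip) s0 (ipZl Hip) (ipZr Hip).
by rewrite conjc_real.
Qed.

(* Schur complements of the tridiagonal block Toeplitz operators. *)
Fixpoint schur (n : nat) : H -> H :=
  if n is n'.+1 then fun x => A x - phi 2 (opinv (schur n') (phi 1 x)) else A.

Let trid n (s : nat -> H) : R :=
  \sum_(a < n.+1) rp (A (s a)) (s a) + \sum_(a < n) 2 * rp (phi 1 (s a)) (s a.+1).

Let trid_ge n s : e * rp (s 0) (s 0) <= trid n s.
Proof.
have /complex_ge0[] := tridiag_pos n s; rewrite ReD !Re_sum => h _.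
rewrite /trid; under eq_bigr do rewrite /A !rpE.
rewrite big_split /= -mulr_sumr [X in _ + e * X]big_ord_recl mulrDr.
have h1 : 0 <= e * \sum_(i < n) rp (s (bump 0 i)) (s (bump 0 i)).
  by rewrite mulr_ge0 ?(ltW e0) // sumr_ge0 // => i _; exact: rp_ge0.
have h2 : \sum_(a < n) 2 * rp (phi 1 (s a)) (s a.+1) = 
  \sum_(a < n) Re (ip (phi 1 (s a)) (s a.+1) + ip (phi 2 (s a.+1)) (s a)).
  apply: eq_bigr => a _; rewrite ReD tridiag_adjoint' -!/(rp _ _).
  by rewrite [rp (s a.+1) _](rpC Hip); ring.
rewrite h2; rewrite -!/(rp _ _) in h; move: h.
under eq_bigr do rewrite -/(rp _ _).
move: h1 => /=; lra.
Qed.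

(** [<Z_n x, x>] is a value of the tridiagonal form at a sequence starting with [x], so [trid_ge]
    makes [Z_n] coercive. Coercivity gives the inverse from which [Z_(n+1)] is formed, hence the
    joint induction. *)
Let schur_ok n : [/\ bounded_op ip (schur n), selfadj ip (schur n),
  coercive ip e (schur n) &
  forall x, exists2 s, s 0 = x & trid n s = rp (schur n x) x].
Proof.
suff : [/\ bounded_op ip (schur n), selfadj ip (schur n) &
  forall x, exists2 s, s 0 = x & trid n s = rp (schur n x) x].
  move=> [bZ sZ hZ]; split=> //; split=> // x.
  by have [s s0 <-] := hZ x; rewrite -s0; exact: trid_ge.
elim: n => [|n [bZ sZ hZ]].
  split=> // x; exists (fun=> x) => //.
  by rewrite /trid big_ord1 big_ord0 addr0.
have cZ : coercive ip e (schur n).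
  by split=> // x; have [s s0 <-] := hZ x; rewrite -s0; exact: trid_ge.
have bD := opinv_bounded ipP ip_complete bZ cZ.
have sD := opinv_selfadj ipP ip_complete bZ cZ sZ.
have ZD y := opinvK ipP ip_complete y bZ cZ.
split.
- exact: (bounded_add Hip bA (bounded_opp Hip
    (bounded_comp Hip (bphi 2) (bounded_comp Hip bD (bphi 1))))).
- move=> x y /=; rewrite (ipBl Hip) (ipBr Hip) sA; congr (_ - _).
  by rewrite tridiag_adjoint' sD tridiag_adjoint.
(* The minimizer of [2 Re <phi_1 x, y> + <Z_n y, y>]; [x] is then put in front of a sequence
   realizing [<Z_n y, y>]. *)
move=> x; pose y := - opinv (schur n) (phi 1 x).
have [s s0 hs] := hZ y.
exists (fun m => if m is m'.+1 then s m' else x) => //.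
rewrite /trid big_ord_recl [X in _ + X]big_ord_recl /= s0.
have -> : rp (A x) x + \sum_(i < n.+1) rp (A (s i)) (s i) + (2 * rp (phi 1 x) y +
   \sum_(i < n) 2 * rp (phi 1 (s i)) (s i.+1)) = rp (A x) x + 2 * rp (phi 1 x) y + trid n s.
  by rewrite /trid; ring.
rewrite hs.
have -> : rp (schur n y) y = - rp (phi 1 x) y.
  by rewrite /y (linopN _ (bounded_linop bZ)) ZD rpNl.
rewrite /y !rpE.
have -> : rp (phi 2 (opinv (schur n) (phi 1 x))) x = rp (phi 1 x) (opinv (schur n) (phi 1 x)).
  by rewrite {1}/re_ip tridiag_adjoint' -/(rp _ _) (rpC Hip).
by ring.
Qed.

Variables (I : finType) (k : nat) (X : 'I_3 -> 'I_k -> I -> I -> R[i]).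
Variables (psi : 'I_k -> H -> H).
Hypothesis lpsi : forall j, linop (psi j).
Hypothesis comm : forall i j x, phi i (psi j x) = psi j (phi i x).
Hypothesis block_pos : forall xi : bool -> I -> H,
  0 <= \sum_p \sum_q \sum_a \sum_b \sum_j (\sum_i Sd_basis i p q * X i j a b)
                             * ip (psi j (xi q b)) (xi p a).
Variable xi : I -> H.
Let g := opform ip X psi xi.

Let schur_comm n j x : schur n (psi j x) = psi j (schur n x).
Proof.
have Ac y : A (psi j y) = psi j (A y).
  by rewrite /A comm (linopD _ _ (lpsi j)) (linopZ _ _ (lpsi j)).
elim: n x => [|n IH] x; first exact: Ac.
have [bZ _ cZ _] := schur_ok n.
rewrite /= Ac comm (opinv_comm ipP ip_complete _ bZ cZ) // comm.
by rewrite [RHS](linopB _ _ (lpsi j)).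
Qed.

(** Choi's correspondence: a positive 2 x 2 operator matrix is a completely positive map on M_2,
    sending [I] to the sum of the diagonal entries and [E_12], [E_21] to the off-diagonal ones. *)
Let choi_form (Cp : bool -> bool -> H -> H) :
  (forall p q, bounded_op ip (Cp p q)) ->
  (forall p q j x, Cp p q (psi j x) = psi j (Cp p q x)) ->
  (forall u v, 0 <= ip (Cp false false u) u + ip (Cp false true v) u
                  + ip (Cp true false u) v + ip (Cp true true v) v) ->
  0 <= g 0 (Cp false false) + g 1 (Cp false true) + g 2 (Cp true false) + g 0 (Cp true true).
Proof.
move=> bC cC pC.
have h1 (eta : bool -> H) : 0 <= \sum_p \sum_q ip (Cp p q (eta q)) (eta p).
  have := pC (eta false) (eta true); rewrite !big_bool /=; congr (0 <= _).
  by ring.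
have := @product_pos _ _ _ Hip _ _ _ _ _ psi bC lpsi cC h1 block_pos xi.
rewrite !big_bool /= !(opform_mix ip X psi xi) !big_ord3 /Sd_basis /= -/g.
by congr (0 <= _); rewrite !mul0r !mul1r; ring.
Qed.

Let schur_step n :
  0 <= g 0 (schur n) + g 1 (phi 1) + g 2 (phi 2) + (g 0 A - g 0 (schur n.+1)).
Proof.
have [bZ sZ cZ _] := schur_ok n.
have bD := opinv_bounded ipP ip_complete bZ cZ.
have sD := opinv_selfadj ipP ip_complete bZ cZ sZ.
have ZD y := opinvK ipP ip_complete y bZ cZ.
have -> : g 0 A - g 0 (schur n.+1) = g 0 (fun x => phi 2 (opinv (schur n) (phi 1 x))).
  apply/eqP; rewrite subr_eq -(opformD Hip); apply/eqP; apply: eq_opform => x /=.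
  by rewrite addrC subrK.
pose Cp (p q : bool) := if p then (if q then fun x => phi 2 (opinv (schur n) (phi 1 x))
  else phi 2) else (if q then phi 1 else schur n).
apply: (choi_form (Cp := Cp)).
- move=> [] [] //=.
  exact: (bounded_comp Hip (bphi 2) (bounded_comp Hip bD (bphi 1))).
- move=> [] [] j x //=; rewrite comm (opinv_comm ipP ip_complete _ bZ cZ) ?comm //.
move=> u v /=; set d := opinv _ _.
have pZ : posop ip (schur n).
  apply: (selfadj_posop Hip) => // y; have [_ h] := cZ; apply: le_trans (h y).
  by rewrite mulr_ge0 ?(rp_ge0 Hip) // ltW.
(* Completing the square: with [d = Z_n^-1 phi_1 v] the form of the block matrix is
   [<Z_n (u + d), u + d>]. *)
have := pZ (u + d); congr (0 <= _).
rewrite (linopD _ _ (bounded_linop bZ)) ZD (ipDl Hip) !(ipDr Hip).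
rewrite (sZ u d) ZD -tridiag_adjoint' [ip (phi 2 d) v]tridiag_adjoint'.
by rewrite [ip d (phi 1 v)]sD -/d addrA [X in X + _]addrAC.
Qed.

(** The block matrix [[[Z_n, 0], [0, 0]]]. This disposes of the last term [- g 0 Z_N] of the
    telescoping sum. *)
Let schur_form_ge0 n : 0 <= g 0 (schur n).
Proof.
have [bZ sZ cZ _] := schur_ok n.
have pZ : posop ip (schur n).
  apply: (selfadj_posop Hip) => // y; have [_ h] := cZ; apply: le_trans (h y).
  by rewrite mulr_ge0 ?(rp_ge0 Hip) // ltW.
pose Cp (p q : bool) := if p || q then fun=> 0 else schur n.
have g0 i : g i (fun=> 0) = 0.
  rewrite /g /opform big1 // => a _; rewrite big1 // => b _; rewrite big1 // => j _.
  by rewrite (ip0l Hip) mulr0.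
have := @choi_form Cp; rewrite /Cp /= !g0 !addr0; apply.
- by move=> [] [] //=; exact: bounded_0.
- by move=> [] [] j x //=; rewrite (linop0 (lpsi j)).
by move=> u v; rewrite !(ip0l Hip) !addr0; exact: pZ.
Qed.

Lemma tridiag_limit :
  0 <= g 0 (phi 0) + g 1 (phi 1) + g 2 (phi 2) + e%:C * g 0 id.
Proof.
have telescope N : 0 <= N%:R * (g 0 A + g 1 (phi 1) + g 2 (phi 2)) + (g 0 A - g 0 (schur N)).
  elim: N => [|N IH]; first by rewrite mul0r add0r subrr.
  have := addr_ge0 IH (schur_step N); congr (0 <= _).
  by rewrite -[in RHS]natr1; ring.
have : 0 <= g 0 A + g 1 (phi 1) + g 2 (phi 2).
  apply: (@ge0_of_affine _ _ (g 0 A)) => N.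
  have := addr_ge0 (telescope N) (schur_form_ge0 N); congr (0 <= _); ring.
have -> : g 0 A = g 0 (phi 0) + e%:C * g 0 id.
  by rewrite -(opformZ Hip) -(opformD Hip).
by congr (0 <= _); ring.
Qed.

End TridiagonalPositive.

Lemma tridiag_commuting_pos (R : realType) (H : lmodType R[i]) (ip : H -> H -> R[i])
  (phi : 'I_3 -> H -> H) (I : finType) (k : nat) (X : 'I_3 -> 'I_k -> I -> I -> R[i])
  (psi : 'I_k -> H -> H) :
  inner_product ip -> complete_ip ip -> (forall i, bounded_op ip (phi i)) ->
  (forall n (x : nat -> H),
  0 <= \sum_(a < n.+1) ip (phi 0 (x a)) (x a)
     + \sum_(a < n) (ip (phi 1 (x a)) (x a.+1) + ip (phi 2 (x a.+1)) (x a))) ->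
  (forall j, linop (psi j)) ->
  (forall i j x, phi i (psi j x) = psi j (phi i x)) ->
  (forall xi : bool -> I -> H,
    0 <= \sum_p \sum_q \sum_a \sum_b \sum_j (\sum_i Sd_basis R i p q * X i j a b)
                               * ip (psi j (xi q b)) (xi p a)) ->
  forall xi : I -> H,
  0 <= \sum_a \sum_b \sum_i \sum_j X i j a b * ip (phi i (psi j (xi b))) (xi a).
Proof.
move=> ipP ipc bphi tp lpsi comm cp xi; rewrite (opformE ip X psi xi phi).
apply: ge0_of_eps => e e0.
exact: (tridiag_limit ipP ipc bphi tp e0 lpsi comm cp xi).
Qed.

(** * Finite-dimensional tests and duality *)

Section FiniteDimensionalSpaces.
Variable R : realType.
Local Notation C := (R[i]).

(** The limit is obtained as the limit inferior, the supremum of the numbers eventually below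
    [u]. *)
Lemma real_cauchy_cvg (u : nat -> R) :
  (forall e, 0 < e -> exists N, forall m n, (N <= m)%N -> (N <= n)%N -> `|u m - u n| < e) ->
  exists l, forall e, 0 < e -> exists N, forall n, (N <= n)%N -> `|u n - l| < e.
Proof.
move=> cu; pose S : set R := fun x => exists N, forall n, (N <= n)%N -> x <= u n.
have ubS N d : (forall n, (N <= n)%N -> `|u N - u n| < d) -> ubound S (u N + d).
  move=> h x [N' hN']; apply: le_trans (hN' _ (leq_maxr N N')) _.
  have := h _ (leq_maxl N N'); rewrite ltr_norml => /andP[]; lra.
have inS N d : (forall n, (N <= n)%N -> `|u N - u n| < d) -> S (u N - d).
  move=> h; exists N => n Nn; have := h n Nn; rewrite ltr_norml => /andP[]; lra.
have [N0 hN0] := cu 1 ltr01.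
have supS : has_sup S.
  split; first by exists (u N0 - 1); apply: inS => n Nn; apply: hN0.
  by exists (u N0 + 1); apply: ubS => n Nn; apply: hN0.
exists (sup S) => e e0; have e2 : 0 < e / 2 by lra.
have [N hN] := cu _ e2; exists N => n Nn.
have h1 : u N - e / 2 <= sup S.
  by apply: (ub_le_sup (proj2 supS)); apply: inS => m Nm; apply: hN.
have h2 : sup S <= u N + e / 2.
  by apply: (ge_sup (proj1 supS)); apply: ubS => m Nm; apply: hN.
have := hN N n (leqnn _) Nn; rewrite !ltr_norml => /andP[h3 h4].
by apply/andP; split; lra.
Qed.

Definition cip (x y : C) : C := x * conjc y.

Lemma cip_self (x : C) : cip x x = (Re x ^+ 2 + Im x ^+ 2)%:C.
Proof. by rewrite /cip -sqr_normc add_Re2_Im2. Qed.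

Lemma cip_inner : inner_product (H := C) cip.
Proof.
split.
- by move=> a x y z; rewrite /cip mulrDl mulrA.
- by move=> x y; rewrite /cip rmorphM /= conjcK mulrC.
- by move=> x; exact: mulcJ_ge0.
- by move=> x /eqP; rewrite mulf_eq0 conjc_eq0 orbb => /eqP.
Qed.

Lemma cip_complete : complete_ip (H := C) cip.
Proof.
move=> u cu.
have cuR f : (forall x : C, f x ^+ 2 <= Re x ^+ 2 + Im x ^+ 2) ->
    (forall x y, f (x - y) = f x - f y) ->
    exists l : R, forall e, 0 < e -> exists N, forall n, (N <= n)%N -> `|f (u n) - l| < e.
  move=> fsq fB; apply: real_cauchy_cvg => e e0.
  have [N hN] := cu (e ^+ 2) (exprn_gt0 _ e0).
  exists N => m n Nm Nn; have := hN m n Nm Nn; rewrite cip_self ltcR => h.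
  rewrite -fB -(ltr_pXn2r (n := 2)) ?nnegrE ?normr_ge0 ?(ltW e0) //.
  by rewrite real_normK ?num_real //; apply: le_lt_trans h.
have [a ha] : exists l : R, forall e, 0 < e -> exists N, forall n, (N <= n)%N -> `|Re (u n) - l| < e.
  by apply: cuR => [x|x y]; rewrite ?ReD ?ReN // lerDl sqr_ge0.
have [b hb] : exists l : R, forall e, 0 < e -> exists N, forall n, (N <= n)%N -> `|Im (u n) - l| < e.
  by apply: cuR => [x|x y]; rewrite ?ImD ?ImN // lerDr sqr_ge0.
exists (a +i* b) => e e0.
pose d := Num.sqrt (e / 2); have e2 : 0 < e / 2 by lra.
have d0 : 0 < d by rewrite sqrtr_gt0.
have [N1 h1] := ha d d0; have [N2 h2] := hb d d0.
exists (maxn N1 N2) => n; rewrite geq_max => /andP[/h1 {}h1 /h2 {}h2].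
have sq x : `|x| < d -> x ^+ 2 < e / 2.
  move=> h; rewrite -(sqr_sqrtr (ltW e2)) -/d -real_normK ?num_real //.
  by rewrite ltr_pXn2r ?nnegrE ?(ltW d0).
rewrite cip_self ltcR ReD ImD ReN ImN /=.
by have := sq _ h1; have := sq _ h2; lra.
Qed.

Variables (J : finType) (V : lmodType C) (ip : V -> V -> C).
Hypothesis ipP : inner_product ip.
Let Hip : semi_ip ip := inner_product_semi ipP.

Lemma ffun_inner : inner_product (ffun_ip (I := J) ip).
Proof.
have [h1 h2 h3] := ffun_semi_ip J Hip; split=> // f /eqP.
rewrite psumr_eq0; last by move=> j _; case: Hip.
move=> /allP h; apply/ffunP => j; rewrite ffunE.
have /eqP := h j (mem_index_enum j).
by case: ipP => _ _ _; exact.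
Qed.

Lemma ffun_complete : complete_ip ip -> complete_ip (ffun_ip (I := J) ip).
Proof.
move=> ipc u cu.
have /choice[l hl] j : exists x, forall e : R, 0 < e -> exists N, forall n, (N <= n)%N ->
    ip (u n j - x) (u n j - x) < e%:C.
  apply: ipc => e e0; have [N hN] := cu e e0; exists N => m n Nm Nn.
  apply: le_lt_trans (hN m n Nm Nn); rewrite /ffun_ip (bigD1 j) //= !ffunE.
  by rewrite lerDl; apply: sumr_ge0 => i _; case: Hip.
exists (finfun l) => e e0; pose d := e / (#|J|%:R + 1).
have J0 : (0 : R) < #|J|%:R + 1 by rewrite ltr_pwDr.
have d0 : 0 < d by rewrite divr_gt0.
have /choice[N hN] j : exists N, forall n, (N <= n)%N -> ip (u n j - l j) (u n j - l j) < d%:C.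
  exact: hl.
exists (\max_j N j) => n hn.
apply: (@le_lt_trans _ _ (\sum_(j : J) d%:C)).
  apply: ler_sum => j _; rewrite !ffunE; apply/ltW/hN; apply: leq_trans hn.
  exact: leq_bigmax.
rewrite sumr_const -rmorphMn /= ltcR -mulr_natr /d mulrAC ltr_pdivrMr //.
by rewrite mulrDr mulr1 ltrDl.
Qed.

(** [K (x) id] on [C^J (x) V]; its counterpart [amp T] is [id (x) T], and the two commute for linear
    [T]. *)
Definition vop (K : J -> J -> C) (f : {ffun J -> V}) : {ffun J -> V} :=
  [ffun p => \sum_q K p q *: f q].

Lemma vop_bounded K : bounded_op (ffun_ip (I := J) ip) (vop K).
Proof.
apply/(bounded_opP (ffun_semi_ip J Hip)); split.
  move=> a x y; apply/ffunP => p; rewrite !ffunE scaler_sumr -big_split /=.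
  by apply: eq_bigr => q _; rewrite !ffunE scalerDr !scalerA mulrC.
have /choice[M hM] (p : J) : exists M : R, 0 <= M /\ forall y : J -> V,
    re_ip ip (\sum_q K p q *: y q) (\sum_q K p q *: y q) <= M * \sum_q re_ip ip (y q) (y q).
  have [M M0 h] := row_bound Hip (fun q => bounded_scale Hip (K p q)).
  by exists M.
exists (\sum_p M p) => [|f]; first by apply: sumr_ge0 => p _; case: (hM p).
rewrite !ffun_rp mulr_suml; apply: ler_sum => p _; rewrite ffunE.
by case: (hM p) => _; exact.
Qed.

Definition amp (T : V -> V) (f : {ffun J -> V}) : {ffun J -> V} := [ffun p => T (f p)].

Lemma amp_bounded T : bounded_op ip T -> bounded_op (ffun_ip (I := J) ip) (amp T).
Proof.
move=> /(bounded_opP Hip)[lT [M M0 hM]]; apply/(bounded_opP (ffun_semi_ip J Hip)).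
split; first by move=> a x y; apply/ffunP => p; rewrite !ffunE lT.
exists M => // f; rewrite !ffun_rp mulr_sumr; apply: ler_sum => p _.
by rewrite ffunE.
Qed.

End FiniteDimensionalSpaces.

(** * Matrix cones as quadratic forms; duality and finite-dimensional tests *)

Section Cones.
Variable R : realType.
Local Notation C := (R[i]).

Definition sesq (I : finType) (K : I -> I -> C) (u v : I -> C) : C :=
  \sum_a \sum_b K a b * (v b * conjc (u a)).

(* The quadratic form of sum_i P_i (x) K_i. *)
Definition pairing k (I J : finType) (K : 'I_k -> J -> J -> C) (P : 'I_k -> I -> I -> C)
    (v : I -> J -> C) : C :=
  \sum_a \sum_b \sum_i P i a b * sesq (K i) (v a) (v b).

(** The cone over an arbitrary finite index type: contracting one tensor factor yields matrices
    indexed by products. *)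
Definition S1_pos (I : finType) (P : 'I_3 -> I -> I -> C) : Prop :=
  forall w, on_circle w -> forall v : I -> 'I_1 -> C,
    0 <= pairing (fun i _ _ => S1_basis w i) P v.

Definition Sd_pos (I : finType) (P : 'I_3 -> I -> I -> C) : Prop :=
  forall v : I -> bool -> C, 0 <= pairing (@Sd_basis R) P v.

Lemma psdP n (A : 'M[C]_n) : psd A <-> forall u, 0 <= sesq (fun a b => A a b) u u.
Proof.
have e (u : 'cV[C]_n) : (adjmx u *m A *m u) 0 0 = sesq (fun a b => A a b) (u^~ 0) (u^~ 0).
  rewrite mxE /sesq [RHS]exchange_big /=; apply: eq_bigr => b _; rewrite mxE mulr_suml.
  by apply: eq_bigr => a _; rewrite !mxE; ring.
split=> [h u|h u]; last by rewrite e.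
have := h (\col_a u a); rewrite e; congr (0 <= _).
by apply: eq_bigr => a _; apply: eq_bigr => b _; rewrite !mxE.
Qed.

Lemma S1_coneP n (X : 'I_3 -> 'M[C]_n) : S1_cone X <-> S1_pos (fun i a b => X i a b).
Proof.
have e w (v : 'I_n -> 'I_1 -> C) : pairing (fun i _ _ => S1_basis w i) (fun i a b => X i a b) v =
   sesq (fun a b => (\sum_i S1_basis w i *: X i) a b) (v^~ 0) (v^~ 0).
  apply: eq_bigr => a _; apply: eq_bigr => b _; rewrite summxE mulr_suml.
  by apply: eq_bigr => i _; rewrite mxE /sesq !big_ord1; ring.
split=> h w hw; first by move=> v; rewrite e; move/psdP: (h w hw); exact.
by apply/psdP => u; have := h w hw (fun a _ => u a); rewrite e.
Qed.

Definition block_idx n (r : bool) (a : 'I_n) : 'I_(n + n) :=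
  if r then rshift n a else lshift n a.

Lemma Sd_mx_sum n (Z : 'I_3 -> 'M[C]_n) (G : 'I_(n + n) -> 'I_(n + n) -> C) :
  \sum_a \sum_b Sd_mx Z a b * G a b =
  \sum_a \sum_b \sum_i Z i a b *
    \sum_r \sum_s Sd_basis R i r s * G (block_idx r a) (block_idx s b).
Proof.
rewrite big_split_ord /=; under eq_bigr do rewrite big_split_ord /=.
under [X in _ + X]eq_bigr do rewrite big_split_ord /=.
rewrite -big_split; apply: eq_bigr => a _ /=; rewrite -!big_split /=.
apply: eq_bigr => b _; rewrite big_ord3 !big_bool /Sd_basis /= /Sd_mx.
rewrite block_mxEul block_mxEur block_mxEdl block_mxEdr /block_idx; ring.
Qed.

Lemma block_idxE n (f : 'I_n -> bool -> C) : exists u : 'I_(n + n) -> C,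
  forall r a, u (block_idx r a) = f a r.
Proof.
exists (fun x => match split x with inl a => f a false | inr a => f a true end).
move=> [] a; rewrite /block_idx.
  by have := unsplitK (inr a : 'I_n + 'I_n) => /= ->.
by have := unsplitK (inl a : 'I_n + 'I_n) => /= ->.
Qed.

Lemma Sd_coneP n (X : 'I_3 -> 'M[C]_n) : Sd_cone X <-> Sd_pos (fun i a b => X i a b).
Proof.
split=> [/psdP h v|h].
  have [u hu] := block_idxE v; have := h u; rewrite /sesq Sd_mx_sum.
  congr (0 <= _); do 3!(apply: eq_bigr => ? _); congr (_ * _).
  by do 2!(apply: eq_bigr => ? _); rewrite !hu.
apply/psdP => u; have := h (fun a r => u (block_idx r a)).
by rewrite /sesq Sd_mx_sum.
Qed.

Lemma pairingC k (I J : finType) (K : 'I_k -> J -> J -> C) (P : 'I_k -> I -> I -> C) v :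
  pairing K P v = pairing P K (fun c a => v a c).
Proof.
have e (I' J' : finType) (K' : 'I_k -> J' -> J' -> C) (P' : 'I_k -> I' -> I' -> C) v' :
    pairing K' P' v' = \sum_i \sum_a \sum_b P' i a b * sesq (K' i) (v' a) (v' b).
  rewrite /pairing [RHS]exchange_big; apply: eq_bigr => a _ /=.
  by rewrite [RHS]exchange_big.
rewrite !e; apply: eq_bigr => i _; rewrite /sesq.
under eq_bigr => a _.
  under eq_bigr => b _.
    rewrite mulr_sumr; under eq_bigr => c _ do rewrite mulr_sumr.
    over.
  rewrite exchange_big; over.
rewrite exchange_big /=; apply: eq_bigr => c _.
under eq_bigr => a _ do rewrite exchange_big.
rewrite exchange_big /=; apply: eq_bigr => d _.
rewrite mulr_sumr; apply: eq_bigr => a _; rewrite mulr_sumr; apply: eq_bigr => b _.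
by ring.
Qed.

Lemma ip_vop (J : finType) (V : lmodType C) (ip : V -> V -> C) (K : J -> J -> C)
    (f g : {ffun J -> V}) : semi_ip ip ->
  ffun_ip ip (vop K f) g = \sum_p \sum_q K p q * ip (f q) (g p).
Proof.
move=> Hip; apply: eq_bigr => p _; rewrite ffunE (ip_suml Hip).
by apply: eq_bigr => q _; rewrite (ipZl Hip).
Qed.

Let cip_semi : semi_ip (H := C) (@cip R) := inner_product_semi (cip_inner R).

(* S_1^d is the matrix ordered dual of S_1: the two families of cones pair positively. *)
Lemma duality (I J : finType) (P : 'I_3 -> I -> I -> C) (Q : 'I_3 -> J -> J -> C) v :
  S1_pos P -> Sd_pos Q -> 0 <= pairing Q P v.
Proof.
move=> hP hQ; pose ip := ffun_ip (I := J) (@cip R).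
have ipP : inner_product ip by apply: ffun_inner; exact: cip_inner.
have ipc : complete_ip ip by apply: ffun_complete; [exact: cip_inner|exact: cip_complete].
have ipv K (f g : {ffun J -> C}) : ip (vop K f) g = sesq K g f by exact: ip_vop.
(* [Sd_pos Q] says that [[[Q_0, Q_1], [Q_2, Q_0]]] is a positive Toeplitz operator over [C^J]; the
   second map is the identity on a one-dimensional system. *)
have := @toeplitz_commuting_pos R _ ip (fun i => vop (V := C) (Q i)) I 1
  (fun i _ a b => P i a b) (fun _ x => x) ipP ipc.
move=> /(_ (fun i => vop_bounded (cip_inner R) (Q i))) h.
have {h} := h _ (fun _ _ _ _ => erefl) (fun _ _ _ => erefl) _ (fun a => finfun (v a)).
have h1 (x y : {ffun J -> C}) : 0 <= ip (vop (Q 0) x) x + ip (vop (Q 1) y) x +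
    ip (vop (Q 2) x) y + ip (vop (Q 0) y) y.
  have := hQ (fun c r => if r then y c else x c); rewrite !ipv; congr (0 <= _).
  rewrite /pairing /sesq -!big_split; apply: eq_bigr => a _ /=.
  rewrite -!big_split; apply: eq_bigr => b _ /=.
  by rewrite big_ord3 !big_bool /Sd_basis /=; ring.
have h2 w : on_circle w -> forall xi : I -> {ffun J -> C},
    0 <= \sum_a \sum_b \sum_(j < 1) (\sum_i S1_basis w i * P i a b) * ip (xi b) (xi a).
  move=> hw xi.
  have : 0 <= \sum_c pairing (fun i _ _ => S1_basis w i) P (fun a (_ : 'I_1) => xi a c).
    by apply: sumr_ge0 => c _; exact: hP.
  congr (0 <= _); rewrite exchange_big; apply: eq_bigr => a _ /=.
  rewrite exchange_big; apply: eq_bigr => b _ /=; rewrite big_ord1 mulr_sumr.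
  apply: eq_bigr => c _; rewrite mulr_suml; apply: eq_bigr => i _.
  by rewrite /sesq !big_ord1 /cip; ring.
move=> /(_ h1 h2); congr (0 <= _).
do 3!(apply: eq_bigr => ? _); rewrite big_ord1 ipv; congr (_ * _).
by do 2!(apply: eq_bigr => ? _); rewrite !ffunE.
Qed.

Definition cp_rep (S : opsys R) (J : finType) (K : 'I_(os_dim S) -> J -> J -> C) : Prop :=
  forall n (P : 'I_(os_dim S) -> 'M[C]_n), os_cone P ->
  forall v : 'I_n -> J -> C, 0 <= pairing K (fun i a b => P i a b) v.

Lemma cp_rep_S1 w : on_circle w -> @cp_rep (S1 R) 'I_1 (fun i _ _ => S1_basis w i).
Proof. by move=> hw n P /S1_coneP /(_ w hw). Qed.

Lemma cp_rep_Sd : @cp_rep (S1d R) bool (@Sd_basis R).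
Proof. by move=> n P /Sd_coneP. Qed.

(** Tests the c-cone on the commuting pair [K1 (x) id], [id (x) K2] over [C^J1 (x) C^J2]; point
    evaluations and the inclusion in M_2 then give the inclusion of c in min. *)
Lemma c_cone_test (S T : opsys R) (J1 J2 : finType) (K1 : 'I_(os_dim S) -> J1 -> J1 -> C)
    (K2 : 'I_(os_dim T) -> J2 -> J2 -> C) n (X : tens_elt S T n) :
  cp_rep K1 -> cp_rep K2 -> c_cone X -> forall v : 'I_n -> J1 -> J2 -> C,
  0 <= \sum_a \sum_b \sum_i \sum_j X i j a b *
    \sum_p \sum_q K1 i p q * sesq (K2 j) (v a p) (v b q).
Proof.
move=> cp1 cp2 cX v.
pose ip2 := ffun_ip (I := J2) (@cip R); pose ip := ffun_ip (I := J1) ip2.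
have ip2P : inner_product ip2 by apply: ffun_inner; exact: cip_inner.
have ip2s := inner_product_semi ip2P.
have ip2v K (f g : {ffun J2 -> C}) : ip2 (vop K f) g = sesq K g f by exact: ip_vop.
have ipP : inner_product ip by apply: ffun_inner.
have ipv K f g : ip (vop K f) g = \sum_p \sum_q K p q * ip2 (f q) (g p).
  by exact: ip_vop.
have ipc : complete_ip ip.
  by do 2!(apply: ffun_complete => //; try exact: cip_inner); exact: cip_complete.
pose phi i := vop (J := J1) (V := {ffun J2 -> C}) (K1 i).
pose psi j := amp (J := J1) (vop (V := C) (K2 j)).
have bphi i : bounded_op ip (phi i) by exact: vop_bounded.
have bpsi j : bounded_op ip (psi j).
  by apply: amp_bounded => //; apply: vop_bounded; exact: cip_inner.
have := cX _ ip ipP ipc phi psi _ _ _ (fun a => [ffun p => [ffun r => v a p r]]).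
have h1 : cp_map ip phi.
  split=> // m P hP xi.
  have : 0 <= \sum_r pairing K1 (fun i a b => P i a b) (fun a p => xi a p r).
    by apply: sumr_ge0 => r _; exact: cp1.
  congr (0 <= _); rewrite exchange_big; apply: eq_bigr => a _ /=.
  rewrite exchange_big; apply: eq_bigr => b _ /=.
  rewrite exchange_big; apply: eq_bigr => i _ /=; rewrite -mulr_sumr; congr (_ * _).
  rewrite /phi ipv exchange_big; apply: eq_bigr => p _ /=.
  by rewrite exchange_big; apply: eq_bigr => q _ /=; rewrite mulr_sumr.
have h2 : cp_map ip psi.
  split=> // m P hP xi.
  have : 0 <= \sum_p pairing K2 (fun i a b => P i a b) (fun a r => xi a p r).
    by apply: sumr_ge0 => r _; exact: cp2.
  congr (0 <= _); rewrite exchange_big; apply: eq_bigr => a _ /=.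
  rewrite exchange_big; apply: eq_bigr => b _ /=.
  rewrite exchange_big; apply: eq_bigr => i _ /=; rewrite -mulr_sumr; congr (_ * _).
  by apply: eq_bigr => p _; rewrite ffunE ip2v.
have h3 i j x : phi i (psi j x) = psi j (phi i x).
  apply/ffunP => p; rewrite !ffunE.
  have bj := vop_bounded (cip_inner R) (K2 j).
  rewrite (linop_sum _ (bounded_linop bj)); apply: eq_bigr => q _.
  by rewrite ffunE (linopZ _ _ (bounded_linop bj)).
move=> /(_ h1 h2 h3); congr (0 <= _).
do 4!(apply: eq_bigr => ? _); congr (_ * _).
rewrite /phi ipv; do 2!(apply: eq_bigr => ? _); rewrite !ffunE ip2v; congr (_ * _).
by do 2!(apply: eq_bigr => ? _); rewrite !ffunE.
Qed.

End Cones.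

(** * The minimal and commuting tensor products *)

Section MinEqualsCommuting.
Variable R : realType.
Local Notation C := (R[i]).

Lemma big_ord2 (F : 'I_2 -> C) : \sum_i F i = F 0 + F 1.
Proof.
rewrite !big_ord_recl big_ord0 addr0.
by congr (_ + F _); apply/val_inj.
Qed.

(** The element [[[1, z], [zbar, 1]]], of rank one at each point: its form is [|v_0 + w v_1|^2]. *)
Lemma S1_cone_generator :
  S1_cone (fun i => \matrix_(a < 2, b < 2) Sd_basis R i (a == 1) (b == 1)).
Proof.
apply/S1_coneP => w hw v.
have := mulcJ_ge0 (v 0 0 + w * v 1 0); congr (0 <= _).
rewrite /pairing /sesq !big_ord2 !big_ord3 !big_ord1 !mxE /Sd_basis /S1_basis /=.
rewrite rmorphD rmorphM /=.
transitivity (v 0 0 * conjc (v 0 0) + w * (v 1 0 * conjc (v 0 0)) +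
  conjc w * (v 0 0 * conjc (v 1 0)) + (w * conjc w) * (v 1 0 * conjc (v 1 0))); first by ring.
by rewrite (circle_conj hw); ring.
Qed.

Lemma cp_S1_toeplitz (H : lmodType C) (ip : H -> H -> C) (phi : 'I_3 -> H -> H) :
  cp_map (S := S1 R) ip phi -> forall x y,
  0 <= ip (phi 0 x) x + ip (phi 1 y) x + ip (phi 2 x) y + ip (phi 0 y) y.
Proof.
move=> [_ cp] x y; have := cp 2 _ S1_cone_generator (fun a => if a == 1 then y else x).
congr (0 <= _); rewrite !big_ord2 /= !big_ord3 !mxE /Sd_basis /=.
by ring.
Qed.

Lemma S1_commuting (T : opsys R) n (X : tens_elt (S1 R) T n) :
  (forall w, on_circle w -> os_cone (o := T) (fun j => \sum_(i < 3) S1_basis w i *: X i j)) ->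
  c_cone X.
Proof.
move=> h H ip ipP ipc phi psi cphi cpsi comm xi.
apply: (@toeplitz_commuting_pos R H ip phi 'I_n _ (fun i j a b => X i j a b) psi) => //.
- by case: cphi.
- exact: (cp_S1_toeplitz cphi).
- by move=> j; case: cpsi => b _; case: (b j).
move=> w hw {}xi; case: cpsi => _ /(_ n _ (h w hw) xi); congr (0 <= _).
by do 3!(apply: eq_bigr => ? _); rewrite summxE; congr (_ * _); apply: eq_bigr => i _; rewrite mxE.
Qed.

Lemma min_eq_c_S1S1 : same_cones (@min_cone_S1S1 R) (@c_cone R (S1 R) (S1 R)).
Proof.
move=> n X; split=> [h|h].
  apply: S1_commuting => w1 hw1 w2 hw2; have := h w1 w2 hw1 hw2.
  congr psd; rewrite exchange_big; apply: eq_bigr => j _ /=.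
  by rewrite scaler_sumr; apply: eq_bigr => i _; rewrite scalerA mulrC.
move=> w1 w2 hw1 hw2; apply/psdP => u.
have := c_cone_test (cp_rep_S1 hw1) (cp_rep_S1 hw2) h (fun a _ _ => u a).
congr (0 <= _); apply: eq_bigr => a _; apply: eq_bigr => b _.
rewrite summxE mulr_suml; apply: eq_bigr => i _; rewrite summxE mulr_suml.
by apply: eq_bigr => j _; rewrite /sesq !big_ord1 !mxE; ring.
Qed.

Lemma min_eq_c_S1Sd : same_cones (@min_cone_S1Sd R) (@c_cone R (S1 R) (S1d R)).
Proof.
move=> n X; split=> [h|h]; first exact: S1_commuting.
move=> w hw; apply/Sd_coneP => v.
have := c_cone_test (cp_rep_S1 hw) (@cp_rep_Sd R) h (fun a _ r => v a r).
congr (0 <= _); apply: eq_bigr => a _; apply: eq_bigr => b _.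
rewrite exchange_big; apply: eq_bigr => j _ /=; rewrite summxE mulr_suml.
by apply: eq_bigr => i _; rewrite !big_ord1 mxE; ring.
Qed.

Lemma sum_delta n (F : 'I_n -> C) (a : 'I_n) : \sum_b (a == b)%:R * F b = F a.
Proof.
rewrite (bigD1 a) //= eqxx mul1r big1 ?addr0 // => b ba.
by rewrite eq_sym (negbTE ba) mul0r.
Qed.

Lemma sum_shift n (F : 'I_n.+1 -> 'I_n.+1 -> C) :
  \sum_(a < n.+1) \sum_(b < n.+1) (a == b.+1 :> nat)%:R * F a b =
  \sum_(i < n) F (lift ord0 i) (widen_ord (leqnSn n) i).
Proof.
rewrite big_ord_recl [X in X + _]big1 ?add0r; last by move=> b _; rewrite mul0r.
apply: eq_bigr => i _; rewrite (bigD1 (widen_ord (leqnSn n) i)) // lift0 eqxx mul1r.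
rewrite big1 /= ?addr0 // => b /negbTE bi; rewrite eqSS.
by rewrite eq_sym -val_eqE /= in bi; rewrite bi mul0r.
Qed.

(** The block matrix [[[1, N], [N^*, 1]]] with [N] the nilpotent shift, a contraction. The form is
    the sum of the [|x_(i+1) + y_i|^2] and the two unmatched ends [|x_0|^2], [|y_n|^2]. *)
Lemma Sd_cone_shift n : Sd_cone (fun i => \matrix_(a < n.+1, b < n.+1)
  (match val i with
   | 0 => (a == b)%:R | 1 => (a == b.+1 :> nat)%:R | _ => (b == a.+1 :> nat)%:R
   end : C)).
Proof.
apply/Sd_coneP => v.
pose x a := v a false; pose y a := v a true.
have : 0 <= \sum_(i < n) (x (lift ord0 i) + y (widen_ord (leqnSn n) i)) *
     conjc (x (lift ord0 i) + y (widen_ord (leqnSn n) i)) +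
     x ord0 * conjc (x ord0) + y ord_max * conjc (y ord_max).
  by rewrite !addr_ge0 ?mulcJ_ge0 // sumr_ge0 // => i _; exact: mulcJ_ge0.
congr (0 <= _).
transitivity (\sum_(a < n.+1) \sum_(b < n.+1) (a == b)%:R * (x b * conjc (x a) + y b * conjc (y a)) +
  \sum_(a < n.+1) \sum_(b < n.+1) (a == b.+1 :> nat)%:R * (y b * conjc (x a)) +
  \sum_(b < n.+1) \sum_(a < n.+1) (b == a.+1 :> nat)%:R * (x b * conjc (y a))); last first.
  rewrite [X in _ + X]exchange_big -!big_split; apply: eq_bigr => a _ /=.
  rewrite -!big_split; apply: eq_bigr => b _ /=.
  by rewrite big_ord3 /sesq !big_bool !mxE /Sd_basis /= -/(x _) -/(x _) -/(y _) -/(y _); ring.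
rewrite !sum_shift; under [in RHS]eq_bigr do rewrite sum_delta.
rewrite big_split /= [in RHS]big_ord_recl [X in _ + X + _ + _]big_ord_recr /=.
transitivity (\sum_(i < n) x (lift ord0 i) * conjc (x (lift ord0 i)) +
  \sum_(i < n) y (widen_ord (leqnSn n) i) * conjc (y (widen_ord (leqnSn n) i)) +
  \sum_(i < n) y (widen_ord (leqnSn n) i) * conjc (x (lift ord0 i)) +
  \sum_(i < n) x (lift ord0 i) * conjc (y (widen_ord (leqnSn n) i)) +
  x ord0 * conjc (x ord0) + y ord_max * conjc (y ord_max)); last by ring.
do 2!congr (_ + _); rewrite -!big_split; apply: eq_bigr => i _ /=.
by rewrite rmorphD /=; ring.
Qed.

Lemma cp_Sd_tridiag (H : lmodType C) (ip : H -> H -> C) (phi : 'I_3 -> H -> H) :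
  cp_map (S := S1d R) ip phi -> forall n (x : nat -> H),
  0 <= \sum_(a < n.+1) ip (phi 0 (x a)) (x a)
     + \sum_(a < n) (ip (phi 1 (x a)) (x a.+1) + ip (phi 2 (x a.+1)) (x a)).
Proof.
move=> [_ cp] n x; have := cp n.+1 _ (@Sd_cone_shift n) (fun a => x a).
congr (0 <= _).
transitivity (\sum_(a < n.+1) \sum_(b < n.+1) (a == b)%:R * ip (phi 0 (x b)) (x a) +
  (\sum_(a < n.+1) \sum_(b < n.+1) (a == b.+1 :> nat)%:R * ip (phi 1 (x b)) (x a) +
  \sum_(b < n.+1) \sum_(a < n.+1) (b == a.+1 :> nat)%:R * ip (phi 2 (x b)) (x a))).
  rewrite [X in _ = _ + (_ + X)]exchange_big -!big_split; apply: eq_bigr => a _ /=.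
  rewrite -!big_split; apply: eq_bigr => b _ /=.
  by rewrite big_ord3 !mxE /= addrA.
rewrite (sum_shift (fun a b : 'I_n.+1 => ip (phi 1 (x b)) (x a))).
rewrite (sum_shift (fun b a : 'I_n.+1 => ip (phi 2 (x b)) (x a))) -big_split /=; congr (_ + _).
by apply: eq_bigr => a _; rewrite (sum_delta (fun b : 'I_n.+1 => ip (phi 0 (x b)) (x a))).
Qed.

Lemma min_SdSd_of_form n (X : tens_elt (S1d R) (S1d R) n) :
  (forall v : 'I_n -> bool -> bool -> C,
    0 <= \sum_a \sum_b \sum_(i < 3) \sum_(j < 3) X i j a b *
      \sum_p \sum_q Sd_basis R i p q * sesq (Sd_basis R j) (v a p) (v b q)) ->
  min_cone_SdSd X.
Proof.
move=> h; apply/Sd_coneP => v.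
have := h (fun a p r => v (block_idx p a) r).
congr (0 <= _); rewrite [RHS]/pairing.
under [RHS]eq_bigr => a _ do rewrite exchange_big.
rewrite [RHS]exchange_big /=.
under [RHS]eq_bigr => j _ do rewrite Sd_mx_sum.
rewrite [RHS]exchange_big; apply: eq_bigr => a _ /=.
rewrite [RHS]exchange_big; apply: eq_bigr => b _ /=.
by rewrite [RHS]exchange_big.
Qed.

Lemma min_eq_c_SdSd : same_cones (@min_cone_SdSd R) (@c_cone R (S1d R) (S1d R)).
Proof.
move=> n X; split=> [h|h].
  move=> H ip ipP ipc phi psi cphi cpsi comm xi.
  apply: (@tridiag_commuting_pos R H ip phi 'I_n _ (fun i j a b => X i j a b) psi) => //.
  - by case: cphi.
  - exact: (cp_Sd_tridiag cphi).
  - by move=> j; case: cpsi => b _; case: (b j).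
  move=> {}xi; pose zeta (x : 'I_(n + n)) := match split x with
    inl a => xi false a | inr a => xi true a end.
  have zE r a : zeta (block_idx r a) = xi r a.
    case: r; rewrite /zeta /block_idx.
      by have := unsplitK (inr a : 'I_n + 'I_n) => /= ->.
    by have := unsplitK (inl a : 'I_n + 'I_n) => /= ->.
  case: cpsi => _ /(_ (n + n)%N (fun j => Sd_mx (fun i => X i j)) h zeta).
  congr (0 <= _).
  under eq_bigr => a _ do rewrite exchange_big.
  rewrite exchange_big /=.
  under eq_bigr => j _ do rewrite Sd_mx_sum.
  under [RHS]eq_bigr => p _.
    under eq_bigr => q _.
      under eq_bigr => a _ do rewrite exchange_big.
      rewrite exchange_big; over.
    rewrite exchange_big; over.
  rewrite [RHS]exchange_big /=; apply: eq_bigr => j _.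
  under [RHS]eq_bigr => p _.
    rewrite exchange_big /=.
    under eq_bigr => a _ do rewrite exchange_big.
    over.
  rewrite [RHS]exchange_big /=; apply: eq_bigr => a _.
  rewrite [RHS]exchange_big /=; apply: eq_bigr => b _.
  under eq_bigr => i _ do rewrite mulr_sumr.
  rewrite exchange_big /=; apply: eq_bigr => p _.
  under eq_bigr => i _ do rewrite mulr_sumr.
  rewrite exchange_big /=; apply: eq_bigr => q _.
  by rewrite mulr_suml; apply: eq_bigr => i _; rewrite !zE; ring.
apply: min_SdSd_of_form => v.
exact: (c_cone_test (@cp_rep_Sd R) (@cp_rep_Sd R) h v).
Qed.

End MinEqualsCommuting.

(** * The maximal tensor product *)

Section MaxDiffers.
Variable R : realType.
Local Notation C := (R[i]).

Lemma sum_pair (I J : finType) (F : I * J -> C) : \sum_x F x = \sum_a \sum_b F (a, b).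
Proof. by rewrite (pair_bigA _ (fun a b => F (a, b))); apply: eq_bigr => -[]. Qed.

Lemma sum_tensor l (J A : finType) (K : 'I_l -> J -> J -> C) (M : 'I_l -> A -> A -> C)
    (W : J * A -> J * A -> C) :
  \sum_s \sum_t (\sum_j K j s.1 t.1 * M j s.2 t.2) * W s t =
  \sum_a \sum_b \sum_j M j a b * \sum_p \sum_q K j p q * W (p, a) (q, b).
Proof.
rewrite sum_pair exchange_big; apply: eq_bigr => a _ /=.
under eq_bigr => p _ do rewrite sum_pair exchange_big.
rewrite exchange_big; apply: eq_bigr => b _ /=.
under [RHS]eq_bigr => j _ do rewrite mulr_sumr.
rewrite [RHS]exchange_big; apply: eq_bigr => p _ /=.
under [RHS]eq_bigr => j _ do rewrite mulr_sumr.
rewrite [RHS]exchange_big; apply: eq_bigr => q _ /=.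
by rewrite mulr_suml; apply: eq_bigr => j _; ring.
Qed.

Lemma pairing_tensor k l (I J A : finType) (K : 'I_l -> J -> J -> C)
    (L : 'I_k -> I -> I -> C) (M : 'I_k -> 'I_l -> A -> A -> C) (v : J * A -> I -> C) :
  pairing L (fun i s t => \sum_j K j s.1 t.1 * M i j s.2 t.2) v =
  \sum_a \sum_b \sum_i \sum_j M i j a b *
     \sum_p \sum_q K j p q * sesq (L i) (v (p, a)) (v (q, b)).
Proof.
rewrite /pairing; under eq_bigr do rewrite exchange_big.
rewrite exchange_big /=; under eq_bigr do rewrite sum_tensor.
rewrite exchange_big; apply: eq_bigr => a _ /=.
by rewrite exchange_big.
Qed.

(** In the form of the sum of all [P_i (x) K_j (x) M_ij] it is immaterial whether [M] is contracted
    with [P] or with [K] first. This is what allows the duality to be used once for each factor. *)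
Lemma pairing_assoc k l (I J A : finType) (K : 'I_l -> J -> J -> C)
    (P : 'I_k -> I -> I -> C) (M : 'I_k -> 'I_l -> A -> A -> C) (v : I * A -> J -> C) :
  pairing K (fun j x y => \sum_i P i x.1 y.1 * M i j x.2 y.2) v =
  pairing (fun i s t => \sum_j K j s.1 t.1 * M i j s.2 t.2) P (fun c s => v (c, s.2) s.1).
Proof.
rewrite (pairing_tensor P K (fun j i => M i j)) /pairing.
under [RHS]eq_bigr => c _.
  under eq_bigr => d _.
    under eq_bigr => i _.
      rewrite /sesq sum_tensor mulr_sumr.
      under eq_bigr => a _.
        rewrite mulr_sumr; under eq_bigr => b _ do rewrite mulr_sumr.
        over.
      over.
    rewrite exchange_big /=.
    under eq_bigr => a _ do rewrite exchange_big /=.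
    over.
  rewrite exchange_big /=.
  under eq_bigr => a _ do rewrite exchange_big /=.
  over.
rewrite [RHS]exchange_big; apply: eq_bigr => a _ /=.
rewrite [RHS]exchange_big; apply: eq_bigr => b _ /=.
under eq_bigr => j _.
  under eq_bigr => i _.
    rewrite mulr_sumr; under eq_bigr => c _ do rewrite mulr_sumr.
    over.
  rewrite exchange_big /=; under eq_bigr => c _ do rewrite exchange_big /=.
  over.
rewrite exchange_big; apply: eq_bigr => c _ /=.
rewrite exchange_big; apply: eq_bigr => d _ /=.
rewrite exchange_big; apply: eq_bigr => i _ /=.
by apply: eq_bigr => j _; rewrite /sesq; ring.
Qed.

Lemma sum_mxtens p q (F : 'I_(p * q) -> C) :
  \sum_x F x = \sum_c \sum_e F (mxtens_index (c, e)).
Proof.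
rewrite (reindex (@mxtens_index p q)) /=; last first.
  by exists (@mxtens_unindex p q) => x _; rewrite ?mxtens_indexK ?mxtens_unindexK.
exact: sum_pair.
Qed.

Lemma tens_conj_entry p q n (P : 'M[C]_p) (Q : 'M[C]_q) (A : 'M[C]_(p * q, n)) a b :
  (adjmx A *m (P *t Q) *m A) a b = \sum_c \sum_d P c d *
    sesq (fun e f => Q e f) (fun e => A (mxtens_index (c, e)) a)
                            (fun f => A (mxtens_index (d, f)) b).
Proof.
rewrite mxE sum_mxtens exchange_big /=.
under eq_bigr => f _.
  under eq_bigr => d _ do rewrite mxE sum_mxtens mulr_suml.
  rewrite exchange_big /=.
  over.
rewrite exchange_big; apply: eq_bigr => c _ /=.
rewrite exchange_big; apply: eq_bigr => d _ /=.
rewrite /sesq [X in _ * X]exchange_big mulr_sumr; apply: eq_bigr => f _ /=.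
rewrite mulr_suml mulr_sumr; apply: eq_bigr => e _.
by rewrite tensmxE !mxE; ring.
Qed.

Definition functional (S T : opsys R) n
    (M : 'I_(os_dim S) -> 'I_(os_dim T) -> 'I_n -> 'I_n -> C) (X : tens_elt S T n) : C :=
  \sum_i \sum_j \sum_a \sum_b M i j a b * X i j a b.

(** The value at [A^* (P (x) Q) A] is the form of the sum of all [P_i (x) Q_j (x) M_ij] at a vector
    read off from the entries of [A]. *)
Lemma functional_max_D (S T : opsys R) n
    (M : 'I_(os_dim S) -> 'I_(os_dim T) -> 'I_n -> 'I_n -> C) (X : tens_elt S T n) :
  (forall p q (P : 'I_(os_dim S) -> 'M[C]_p) (Q : 'I_(os_dim T) -> 'M[C]_q),
    os_cone P -> os_cone Q -> forall v : 'I_p * 'I_n -> 'I_q -> C,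
    0 <= pairing (fun j e f => Q j e f)
           (fun j x y => \sum_i P i x.1 y.1 * M i j x.2 y.2) v) ->
  max_D X -> 0 <= functional M X.
Proof.
move=> h [p [q [P [Q [A [hP [hQ hX]]]]]]].
have := h p q P Q hP hQ (fun x e => A (mxtens_index (x.1, e)) x.2).
congr (0 <= _).
rewrite (pairing_tensor (fun i c d => P i c d) (fun j e f => Q j e f) (fun j i => M i j)).
under eq_bigr => a _ do rewrite exchange_big /=.
rewrite exchange_big /=.
under eq_bigr => j _.
  under eq_bigr => a _ do rewrite exchange_big /=.
  rewrite exchange_big /=.
  over.
rewrite exchange_big; apply: eq_bigr => i _ /=.
apply: eq_bigr => j _; apply: eq_bigr => a _; apply: eq_bigr => b _.
by rewrite hX tens_conj_entry.
Qed.

(** Because of the Archimedeanization, the functional has to be negative at [X + e] for some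
    [e > 0], not merely at [X]. *)
Lemma c_neq_max (S T : opsys R) n
    (M : 'I_(os_dim S) -> 'I_(os_dim T) -> 'I_n -> 'I_n -> C) (X : tens_elt S T n) (e : R) :
  (forall p q (P : 'I_(os_dim S) -> 'M[C]_p) (Q : 'I_(os_dim T) -> 'M[C]_q),
    os_cone P -> os_cone Q -> forall v : 'I_p * 'I_n -> 'I_q -> C,
    0 <= pairing (fun j e f => Q j e f)
           (fun j x y => \sum_i P i x.1 y.1 * M i j x.2 y.2) v) ->
  c_cone X -> 0 < e ->
  functional M (fun i j => X i j + e%:C *: @tens_unit R S T n i j) < 0 ->
  ~ same_cones (@c_cone R S T) (@max_cone R S T).
Proof.
move=> hM cX e0 neg same; have /same /(_ e e0) hD := cX.
by have := lt_le_trans neg (functional_max_D hM hD); rewrite ltxx.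
Qed.

Definition sigma_z : 'M[C]_2 := \matrix_(a, b) ((a == b)%:R * (if a == 0 then 1 else -1)).
Definition sigma_x : 'M[C]_2 := \matrix_(a, b) (a != b)%:R.

(* s + t (sigma_z (z (x) z + c.c.) + sigma_x (z (x) zbar + c.c.)).  As z (x) z and
   z (x) zbar commute while sigma_z and sigma_x do not, (s, t) = (3, -1) gives a positive
   element for S_1 (x) S_1 and (s, t) = (1, 1) one for S_1^d (x) S_1^d, whose pairing
   3 * 2 - 2 * 2 - 2 * 2 is negative. *)
Definition witness (s t : C) (i j : 'I_3) : 'M[C]_2 :=
  match val i, val j with
  | 0, 0 => s%:M
  | 1, 1 | 2, 2 => t *: sigma_z
  | 1, 2 | 2, 1 => t *: sigma_x
  | _, _ => 0
  end.

Lemma witness_sym s t i j : witness s t i j = witness s t j i.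
Proof. by case: i j => [[|[|[|//]]] hi] [[|[|[|//]]] hj]. Qed.

(** At a point of the torus the element is [3 - 2 h sigma_z - 2 g sigma_x] with [|h|, |g| <= 1]. The
    Pauli part has norm at most [2 sqrt 2], and 3 is a convenient larger number. *)
Lemma witness_S1S1 w1 w2 : on_circle w1 -> on_circle w2 -> forall u : 'I_2 -> C,
  0 <= \sum_a \sum_b \sum_i \sum_j
    witness 3 (-1) i j a b * (S1_basis w1 i * S1_basis w2 j * (u b * conjc (u a))).
Proof.
move=> hw1 hw2 u; pose h := Re (w1 * w2); pose g := Re (w1 * conjc w2).
have bnd w w' : on_circle w -> on_circle w' -> `|Re (w * w')| <= 1.
  move=> hw hw'; rewrite -lecR; apply: le_trans (normc_ge_Re _) _.
  by rewrite normrM hw hw' mulr1.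
have hh : `|h| <= 1 by exact: bnd.
have hg : `|g| <= 1 by apply: bnd => //; rewrite /on_circle normcJ.
pose n0 := Re (u 0) ^+ 2 + Im (u 0) ^+ 2; pose n1 := Re (u 1) ^+ 2 + Im (u 1) ^+ 2.
pose p := Re (u 1 * conjc (u 0)).
have : 0 <= 3 * (n0 + n1) - 2 * h * (n0 - n1) - 2 * g * (2 * p).
  have pE : p = Re (u 1) * Re (u 0) + Im (u 1) * Im (u 0).
    by rewrite /p ReM Re_conjc Im_conjc; ring.
  (* Equivalent to [p^2 <= n0 n1]; the difference is the square of the imaginary part of
     [u_1 conj(u_0)]. *)
  have pd : (n0 - n1) ^+ 2 + (2 * p) ^+ 2 <= (n0 + n1) ^+ 2.
    rewrite pE /n0 /n1; have := sqr_ge0 (Re (u 1) * Im (u 0) - Im (u 1) * Re (u 0)); nra.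
  have s0 : 0 <= n0 + n1 by rewrite /n0 /n1 !addr_ge0 ?sqr_ge0.
  move: hh hg pd s0; rewrite !ler_norml; move: (n0 - n1) (2 * p) (n0 + n1) => d q s.
  move=> /andP[h1 h2] /andP[g1 g2] pd s0.
  have hd : h * d <= `|d|.
    apply: le_trans (ler_norm _) _; rewrite normrM ler_piMl // ler_norml h1 h2 //.
  have gq : g * q <= `|q|.
    apply: le_trans (ler_norm _) _; rewrite normrM ler_piMl // ler_norml g1 g2 //.
  have := normr_ge0 d; have := normr_ge0 q.
  have := real_normK (num_real d); have := real_normK (num_real q).
  move: pd => /[swap] <- /[swap] <-; move: `|d| `|q| hd gq => D Q hd gq pd Q0 D0.
  have : 2 * (D + Q) <= 3 * s.
    have e2 : (2 * (D + Q)) ^+ 2 <= (3 * s) ^+ 2.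
      by have := sqr_ge0 (D - Q); have := sqr_ge0 s; lra.
    by rewrite ler_pXn2r ?nnegrE // in e2; lra.
  lra.
rewrite -ler0c; congr (0 <= _).
transitivity (3 * (n0%:C + n1%:C) - 2 * h%:C * (n0%:C - n1%:C) - 2 * g%:C * (2 * p%:C)).
  by rewrite !natr_real_complex -!(rmorphM, rmorphD, rmorphB).
have -> : n0%:C = u 0 * conjc (u 0) by rewrite -cip_self.
have -> : n1%:C = u 1 * conjc (u 1) by rewrite -cip_self.
rewrite -!addcJ !rmorphM /= !conjcK.
rewrite !big_ord2 !big_ord3 /witness /S1_basis /= !mxE /=.
ring.
Qed.

(** [E_12 (x) E_12] and its adjoint act on the span of [e_ff, e_tt], [E_12 (x) E_21] and its adjoint
    on that of [e_ft, e_tf]. On these orthogonal subspaces the Pauli terms do not interact, so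
    [s = t = 1] suffices: four squares. *)
Lemma witness_SdSd (v : 'I_2 -> bool -> bool -> C) :
  0 <= \sum_a \sum_b \sum_(i < 3) \sum_(j < 3) witness 1 1 i j a b *
      \sum_p \sum_q Sd_basis R i p q * sesq (Sd_basis R j) (v a p) (v b q).
Proof.
pose f := v 0 false; pose t := v 0 true; pose f' := v 1 false; pose t' := v 1 true.
pose sq (x : C) := x * conjc x.
have : 0 <= sq (f false + t true) + sq (f' false - t' true)
          + sq (f true + t' false) + sq (f' true + t false).
  by rewrite !addr_ge0 ?mulcJ_ge0.
congr (0 <= _).
rewrite !big_ord2 !big_ord3 /witness /=.
rewrite !mxE /= ?(mul0r, mulr0, mul1r, mulr1, add0r, addr0, mulr0n, mulr1n).
rewrite /sesq !big_bool /Sd_basis /=.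
rewrite ?(mul0r, mul1r, add0r, addr0).
rewrite /sq !rmorphD rmorphN /= /f /t /f' /t'.
ring.
Qed.

Lemma witness_Sd_pos : Sd_pos (fun i (s t : bool * 'I_2) =>
  \sum_j Sd_basis R j s.1 t.1 * witness 1 1 i j s.2 t.2).
Proof.
move=> v; rewrite (pairing_tensor (@Sd_basis R) (@Sd_basis R) (fun i j a b => witness 1 1 i j a b)).
have := witness_SdSd (fun a p r => v (p, a) r); congr (0 <= _).
apply: eq_bigr => a _; apply: eq_bigr => b _; rewrite exchange_big.
by apply: eq_bigr => i _; apply: eq_bigr => j _; rewrite witness_sym.
Qed.

Lemma witness_S1_pos w : on_circle w -> S1_pos (fun i (s t : 'I_1 * 'I_2) =>
  \sum_j S1_basis w j * witness 3 (-1) i j s.2 t.2).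
Proof.
move=> hw w' hw' v.
rewrite (pairing_tensor (fun j (_ _ : 'I_1) => S1_basis w j) _ (fun i j a b => witness 3 (-1) i j a b)).
have := witness_S1S1 hw' hw (fun a => v (0, a) 0); congr (0 <= _).
apply: eq_bigr => a _; apply: eq_bigr => b _; apply: eq_bigr => i _; apply: eq_bigr => j _.
by rewrite /sesq !big_ord1; ring.
Qed.

(** The identity has trace 2, and each of the four Pauli entries contributes the trace 2 of a
    squared symmetric Pauli matrix. *)
Lemma functional_witness s t s' t' c :
  \sum_(i < 3) \sum_(j < 3) \sum_a \sum_b witness s t i j a b *
    (witness s' t' i j + c *: (if (i == 0) && (j == 0) then 1%:M else 0)) a b =
  2 * (s * (s' + c)) + 8 * (t * t').
Proof.
have entry (i j : 'I_3) : \sum_a \sum_b witness s t i j a b *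
    (witness s' t' i j + c *: (if (i == 0) && (j == 0) then 1%:M else 0)) a b =
    match val i, val j with
    | 0, 0 => 2 * (s * (s' + c))
    | 1, 1 | 2, 2 | 1, 2 | 2, 1 => 2 * (t * t')
    | _, _ => 0
    end.
  by case: i j => [[|[|[|//]]] hi] [[|[|[|//]]] hj]; rewrite !big_ord2 /witness /= !mxE /=; ring.
under eq_bigr => i _ do under eq_bigr => j _ do rewrite entry.
by rewrite !big_ord3 /=; ring.
Qed.

Lemma c_neq_max_S1S1 : ~ same_cones (@c_cone R (S1 R) (S1 R)) (@max_cone R (S1 R) (S1 R)).
Proof.
(* At [X + e] the functional is [2 (3 + e) - 8 = -2 + 2 e]. *)
apply: (@c_neq_max (S1 R) (S1 R) 2 (fun i j a b => witness 1 1 i j a b) (witness 3 (-1)) 2^-1).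
- move=> p q P Q /S1_coneP hP /S1_coneP hQ v.
  rewrite pairingC; apply: duality => // v'.
  rewrite (pairing_assoc (@Sd_basis R) (fun i c d => P i c d) (fun i j a b => witness 1 1 i j a b)).
  by apply: duality => //; exact: witness_Sd_pos.
- apply/min_eq_c_S1S1 => w1 w2 hw1 hw2; apply/psdP => u.
  have := witness_S1S1 hw1 hw2 u; congr (0 <= _).
  apply: eq_bigr => a _; apply: eq_bigr => b _.
  rewrite summxE mulr_suml; apply: eq_bigr => i _; rewrite summxE mulr_suml.
  by apply: eq_bigr => j _; rewrite !mxE; ring.
- by rewrite invr_gt0.
rewrite /functional /= functional_witness fmorphV rmorph_nat.
have -> : 2 * (1 * (3 + 2^-1)) + 8 * (1 * -1) = -1 :> C by field.
by rewrite ltrN10.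
Qed.

Lemma c_neq_max_SdSd : ~ same_cones (@c_cone R (S1d R) (S1d R)) (@max_cone R (S1d R) (S1d R)).
Proof.
(* The roles of element and functional are exchanged: the value is now [6 (1 + e) - 8 = -2 + 6 e],
   whence the smaller [e]. *)
apply: (@c_neq_max (S1d R) (S1d R) 2 (fun i j a b => witness 3 (-1) i j a b) (witness 1 1) 4^-1).
- move=> p q P Q /Sd_coneP hP /Sd_coneP hQ v.
  apply: duality => // w hw v'.
  rewrite (pairing_assoc (fun j (_ _ : 'I_1) => S1_basis w j) (fun i c d => P i c d)
    (fun i j a b => witness 3 (-1) i j a b)).
  rewrite pairingC; apply: duality => //; exact: witness_S1_pos.
- by apply/min_eq_c_SdSd; apply: min_SdSd_of_form => v; exact: witness_SdSd.
- by rewrite invr_gt0.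
rewrite /functional /= functional_witness fmorphV rmorph_nat.
have -> : 2 * (3 * (1 + 4^-1)) + 8 * (-1 * 1) = - 2^-1 :> C by field.
by rewrite oppr_lt0 invr_gt0.
Qed.

(** The functional is the duality pairing, so its positivity on the maximal cone is [duality]. The
    element [1 (x) I - z (x) E_12 - zbar (x) E_21], of rank one at each point, has pairing
    [1 - 1 - 1]. *)
Lemma c_neq_max_S1Sd : ~ same_cones (@c_cone R (S1 R) (S1d R)) (@max_cone R (S1 R) (S1d R)).
Proof.
pose X (i j : 'I_3) : 'M[C]_1 := ((i == j)%:R * (if i == 0 then 1 else -1))%:M.
apply: (@c_neq_max (S1 R) (S1d R) 1 (fun i j _ _ => (i == j)%:R) X 2^-1).
- move=> p q P Q /S1_coneP hP /Sd_coneP hQ v.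
  apply: duality => // w hw v'.
  have := hP w hw (fun c => v' (c, 0)); congr (0 <= _); rewrite [RHS]/pairing sum_pair.
  apply: eq_bigr => c _; rewrite big_ord1 sum_pair; apply: eq_bigr => d _; rewrite big_ord1.
  apply: eq_bigr => j _; congr (_ * _); rewrite (bigD1 j) //= eqxx mulr1.
  by rewrite big1 ?addr0 // => i /negbTE ->; rewrite mulr0.
- apply/min_eq_c_S1Sd => w hw; apply/Sd_coneP => v.
  have := mulcJ_ge0 (v 0 false - w * v 0 true); congr (0 <= _).
  rewrite /pairing !big_ord1 !big_ord3 /X /= !summxE !big_ord3 !mxE /S1_basis /=.
  rewrite /sesq !big_bool /Sd_basis /= rmorphB rmorphM /=.
  transitivity (v 0 false * conjc (v 0 false) - w * (v 0 true * conjc (v 0 false)) -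
    conjc w * (v 0 false * conjc (v 0 true)) + (w * conjc w) * (v 0 true * conjc (v 0 true))).
    by ring.
  by rewrite (circle_conj hw); ring.
- by rewrite invr_gt0.
have -> : @functional (S1 R) (S1d R) 1 (fun i j _ _ => (i == j)%:R)
    (fun i j => X i j + (2^-1 : R)%:C *: @tens_unit R (S1 R) (S1d R) 1 i j) = - 2^-1.
  rewrite /functional; under eq_bigr => i _ do under eq_bigr => j _ do rewrite !big_ord1 !mxE.
  by rewrite !big_ord3 /tens_unit /= !mxE /= fmorphV rmorph_nat; field.
by rewrite oppr_lt0 invr_gt0.
Qed.

End MaxDiffers.

Theorem theorem4p4 (R : realType) :
  (* (1) S1 (x)min S1 = S1 (x)c S1 *)
  same_cones (@min_cone_S1S1 R) (@c_cone R (S1 R) (S1 R)) /\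
  (* (2) S1 (x)c S1 <> S1 (x)max S1 *)
  ~ same_cones (@c_cone R (S1 R) (S1 R)) (@max_cone R (S1 R) (S1 R)) /\
  (* (3) S1 (x)min S1^d = S1 (x)c S1^d *)
  same_cones (@min_cone_S1Sd R) (@c_cone R (S1 R) (S1d R)) /\
  (* (4) S1 (x)c S1^d <> S1 (x)max S1^d *)
  ~ same_cones (@c_cone R (S1 R) (S1d R)) (@max_cone R (S1 R) (S1d R)) /\
  (* (5) S1^d (x)min S1^d = S1^d (x)c S1^d *)
  same_cones (@min_cone_SdSd R) (@c_cone R (S1d R) (S1d R)) /\
  (* (6) S1^d (x)c S1^d <> S1^d (x)max S1^d *)
  ~ same_cones (@c_cone R (S1d R) (S1d R)) (@max_cone R (S1d R) (S1d R)).
Proof.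
split; first exact: min_eq_c_S1S1.
split; first exact: c_neq_max_S1S1.
split; first exact: min_eq_c_S1Sd.
split; first exact: c_neq_max_S1Sd.
by split; [exact: min_eq_c_SdSd|exact: c_neq_max_SdSd].
Qed.
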